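(* Let $n\ge2$, let $(C,W)$ be a weighted spherical $\tau$-design on $\mathbb{S}^{n-1}$, $\tau=2k-1+\varepsilon$, $k\ge1$, $\varepsilon\in\{0,1\}$, such that $D(n,\tau)<N_W\le D(n,\tau+1)$. Let $(\alpha_i,\rho_i)_{i=0}^{k-1+\varepsilon}$ be the nodes and weights determined by $n$ and $N_W$ as in the context (with $m=\tau$). If the potential $h$ satisfies $h^{(\tau+1)}\ge0$ on $[-1,1)$, then $$E_h(C,W)\ \ge\ \sum_{i=0}^{k-1+\varepsilon}\rho_i\,h(\alpha_i).$$ This bound cannot be improved by any polynomial $f\in L_h^{(n,\tau)}$; that is, $f_0-f(1)\sum_{i}w_i^2\le\sum_{i=0}^{k-1+\varepsilon}\rho_ih(\alpha_i)$ for every $f\in L_h^{(n,\tau)}$.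
   Context: **Energy and designs.** $\mathbb{S}^{n-1}$ is the unit sphere in $\mathbb{R}^n$. A weighted spherical code $(C,W)$ consists of an $N$-tuple $C=(x_1,\dots,x_N)$ of distinct points of $\mathbb{S}^{n-1}$ and weights $W=(w_1,\dots,w_N)$, $w_i>0$, $\sum_iw_i=1$. Put $N_W=1/\sum_{i=1}^Nw_i^2$. A potential is a continuous extended-real-valued $h:[-1,1]\to\mathbb{R}\cup\{+\infty\}$, finite on $[-1,1)$, and $E_h(C,W)=\sum_{i\ne j}w_iw_jh(x_i\cdot x_j)$. $(C,W)$ is a weighted spherical $\tau$-design if $M_\ell(C,W):=\sum_{i,j=1}^Nw_iw_jP_\ell^{(n)}(x_i\cdot x_j)=0$ for $1\le\ell\le\tau$. **Gegenbauer polynomials.** $d\mu_n(t)=\gamma_n(1-t^2)^{(n-3)/2}dt$ is the probability measure on $[-1,1]$ with $\gamma_n=\Gamma(n/2)/(\sqrt{\pi}\,\Gamma((n-1)/2))$; $P_i^{(n)}$ is the degree $i$ orthogonal polynomial for $\mu_n$ with $P_i^{(n)}(1)=1$. Any real polynomial is expanded as $f=\sum_i f_iP_i^{(n)}$ (so $f_0=\int f\,d\mu_n$). $\mathcal{P}_m$ is the set of real polynomials of degree at most $m$. $L_h^{(n,\tau)}$ is the set of real polynomials $f$ of degree at most $\tau$ with $f(t)\le h(t)$ for $t\in[-1,1)$ (no sign conditions on coefficients). Each such $f$ gives the lower bound $E_h(C,W)\ge f_0-f(1)\sum_iw_i^2$ for $\tau$-designs. **Parameters.** For $m=2k-1+\varepsilon$,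 $\varepsilon\in\{0,1\}$, $k\ge 1$, put $D(n,m)=\binom{n+k-2+\varepsilon}{n-1}+\binom{n+k-2}{n-1}$. For $a,b\in\{0,1\}$ let $t_k^{a,b}$ be the largest zero of the Jacobi polynomial $P_k^{(a+(n-3)/2,\,b+(n-3)/2)}$, $k\ge1$, with $t_0^{1,1}=-1$, and let $I_m=[t_{k-1+\varepsilon}^{1,1-\varepsilon},t_k^{1,\varepsilon}]$. The Levenshtein function is $$L_m(n,s)=\binom{k+n-3+\varepsilon}{n-2}\left[\frac{2k+n-3+2\varepsilon}{n-1}-\frac{(1+s)^{\varepsilon}\left(P_{k-1+\varepsilon}^{(n)}(s)-P_{k+\varepsilon}^{(n)}(s)\right)}{(1-s)\left(\varepsilon P_k^{(n)}(s)+P_{k+\varepsilon}^{(n)}(s)\right)}\right],$$ which is known to be an increasing bijection from $I_m$ onto $[D(n,m),D(n,m+1)]$. With $m=\tau$, let $s\in I_m$ be the unique solution of $L_m(n,s)=N_W$. The Levenshtein polynomial $f_m^{(n,s)}$ is the monic multiple of $(1+t)^{\varepsilon}(t-s)K_{k-1}(t,s)^2$, where $K_{k-1}$ is the reproducing kernel of $\mathcal{P}_{k-1}$ in $L^2((1-t)(1+t)^{\varepsilon}d\mu_n)$. Its distinct roots are $\alpha_0<\alpha_1<\dots<\alpha_{k-1+\varepsilon}=s$, where $\alpha_0\ge -1$ with $\alpha_0=-1$ if and only if $\varepsilon=1$. The weights are $\rho_i=\left(\int\ell_i\,d\mu_n-\ell_i(1)/N_W\right)/\ell_i(\alpha_i)$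 with $\ell_i(t)=\prod_{j\ne i}(t-\alpha_j)$. It is known that the weights are positive and that $f_0=\frac{f(1)}{N_W}+\sum_{i=0}^{k-1+\varepsilon}\rho_if(\alpha_i)$ for every polynomial $f$ of degree at most $m$. *)

(* Defs.v *)
From HB Require Import structures.
From mathcomp Require Export all_boot all_order all_algebra.
From mathcomp Require Export all_classical all_reals all_analysis.

Set Implicit Arguments.
Unset Strict Implicit.
Unset Printing Implicit Defensive.

Import Order.TTheory GRing.Theory Num.Theory.
Import numFieldNormedType.Exports.

Local Open Scope classical_set_scope.
Local Open Scope ring_scope.

Definition Gamma {R : realType} (a : R) : R :=
  \int[lebesgue_measure]_(t in `]0, +oo[) (t `^ (a - 1) * expR (- t)).

(* Integral of f over [-1, 1] against the measure with Lebesgue density w.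
   With a negative exponent, powR vanishes at 0, so the densities below are
   everywhere finite; this only matters at the endpoints. *)
Definition wint {R : realType} (w f : R -> R) : R :=
  \int[lebesgue_measure]_(t in `[-1, 1]) (f t * w t).

Definition orthogonal_poly {R : realType} (w : R -> R) (i : nat) (c : R)
    : {poly R} :=
  xget 0 [set p : {poly R} | [/\ size p = i.+1, p.[1] = c &
    forall q : {poly R}, (size q <= i)%N ->
      wint w (fun t => p.[t] * q.[t]) = 0]].

Definition mu_density {R : realType} (n : nat) (t : R) : R :=
  Gamma (n%:R / 2) / (Num.sqrt pi * Gamma ((n%:R - 1) / 2))
    * (1 - t ^+ 2) `^ ((n%:R - 3) / 2).

Definition gegenbauer {R : realType} (n i : nat) : {poly R} :=
  orthogonal_poly (mu_density n) i 1.

Definition gegenbauer_coefs {R : realType} (n : nat) (f : {poly R}) : nat -> R :=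
  xget (fun=> 0) [set c : nat -> R |
    f = \sum_(i < size f) c i *: gegenbauer n i /\
    forall i, (size f <= i)%N -> c i = 0].

(* Szego's definition: orthogonality for (1 - t)^a (1 + t)^b together with
   P_k(1) = binom(k + a, k). *)
Definition jacobi {R : realType} (k : nat) (a b : R) : {poly R} :=
  orthogonal_poly (fun t => (1 - t) `^ a * (1 + t) `^ b) k
    (\prod_(j < k) ((a + j.+1%:R) / j.+1%:R)).

Definition largest_root {R : realType} (p : {poly R}) : R :=
  xget 0 [set t : R | root p t /\ forall u, root p u -> u <= t].

(* t_k^{a,b}; the value at k = 0 is only used for a = b = 1. *)
Definition jacobi_zero {R : realType} (n k a b : nat) : R :=
  if k is 0 then -1
  else largest_root
         (jacobi k (a%:R + (n%:R - 3) / 2) (b%:R + (n%:R - 3) / 2)).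

(* The norm of the library on 'rV_n is the sup norm, hence the explicit
   Euclidean inner product. *)
Definition dotv {R : realType} (n : nat) (x y : 'rV[R]_n) : R :=
  \sum_(i < n) x 0 i * y 0 i.

Definition sphere {R : realType} (n : nat) : set 'rV[R]_n :=
  [set x | Num.sqrt (dotv x x) = 1].

Definition weighted_code {R : realType} (n N : nat)
    (C : 'I_N -> 'rV[R]_n) (W : 'I_N -> R) : Prop :=
  [/\ forall i, sphere (C i), injective C, forall i, 0 < W i &
      \sum_(i < N) W i = 1].

Definition NW {R : realType} (N : nat) (W : 'I_N -> R) : R :=
  (\sum_(i < N) W i ^+ 2)^-1.

Definition moment {R : realType} (n N : nat)
    (C : 'I_N -> 'rV[R]_n) (W : 'I_N -> R) (l : nat) : R :=
  \sum_(i < N) \sum_(j < N) W i * W j * (gegenbauer n l).[dotv (C i) (C j)].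

Definition weighted_design {R : realType} (n N tau : nat)
    (C : 'I_N -> 'rV[R]_n) (W : 'I_N -> R) : Prop :=
  weighted_code C W /\
  forall l, (1 <= l <= tau)%N -> moment C W l = 0.

(* Only the values of h on [-1, 1] are meaningful. *)
Definition potential {R : realType} (h : R -> \bar R) : Prop :=
  [/\ {within `[-1, 1], continuous h},
      forall t : R, -1 <= t < 1 -> h t \is a fin_num &
      h 1 != -oo%E].

Definition energy {R : realType} (n N : nat) (h : R -> \bar R)
    (C : 'I_N -> 'rV[R]_n) (W : 'I_N -> R) : \bar R :=
  (\sum_(i < N) \sum_(j < N | i != j)
     (W i * W j)%:E * h (dotv (C i) (C j)))%E.

(* f has derivative l at x relative to D: one-sided at an endpoint of an
   interval D, the usual derivative at an interior point. *)
Definition has_derivative_within {R : realType} (D : set R) (f : R -> R)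
    (x l : R) : Prop :=
  (f y - f x) / (y - x) @[y --> within D x^'] --> l.

Fixpoint is_nth_derivative {R : realType} (D : set R) (m : nat)
    (f g : R -> R) : Prop :=
  if m is m'.+1 then
    exists f' : R -> R, is_nth_derivative D m' f f' /\
      forall x, D x -> has_derivative_within D f' x (g x)
  else forall x, D x -> g x = f x.

Definition nonneg_nth_derivative {R : realType} (m : nat) (h : R -> \bar R)
    : Prop :=
  exists2 g : R -> R, is_nth_derivative `[-1, 1[ m (fine \o h) g &
    forall t : R, -1 <= t < 1 -> 0 <= g t.

(* This class does not depend on the dimension. *)
Definition lower_polys {R : realType} (tau : nat) (h : R -> \bar R)
    : set {poly R} :=
  [set f : {poly R} | (size f <= tau.+1)%N /\
           forall t : R, -1 <= t < 1 -> (f.[t]%:E <= h t)%E].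

(* With m = 2k - 1 + e, k >= 1: k = (m + 1) %/ 2 and e = 1 iff m is even.  The
   definitions below take the pair (k, e) instead of m. *)
Definition delsarte_bound (n m : nat) : nat :=
  let k := (m.+1)./2 in
  let e : bool := ~~ odd m in
  ('C(n + k + e - 2, n - 1) + 'C(n + k - 2, n - 1))%N.

Definition levenshtein_interval {R : realType} (n k : nat) (e : bool) : set R :=
  `[jacobi_zero n (k - 1 + e)%N 1%N (1 - e)%N, jacobi_zero n k 1%N e].

Definition levenshtein_fun {R : realType} (n k : nat) (e : bool) (s : R) : R :=
  'C((k + n + e - 3)%N, (n - 2)%N)%:R *
  (((2 * k + n + 2 * e)%N%:R - 3) / (n%:R - 1)
   - (1 + s) ^+ e *
     ((gegenbauer n (k - 1 + e)%N).[s] - (gegenbauer n (k + e)%N).[s])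
     / ((1 - s) *
        (e%:R * (gegenbauer n k).[s] + (gegenbauer n (k + e)%N).[s]))).

(* t |-> K(t, s), where K is the reproducing kernel of the polynomials of
   degree < d in L^2(w dt). *)
Definition reproducing_kernel {R : realType} (w : R -> R) (d : nat) (s : R)
    : {poly R} :=
  xget 0 [set p : {poly R} | (size p <= d)%N /\
    forall q : {poly R}, (size q <= d)%N ->
      wint w (fun t => q.[t] * p.[t]) = q.[s]].

Definition levenshtein_poly {R : realType} (n k : nat) (e : bool) (s : R)
    : {poly R} :=
  let K := reproducing_kernel
             (fun t => (1 - t) * (1 + t) ^+ e * mu_density n t) k s in
  let F := (1 + 'X) ^+ e * ('X - s%:P) * K ^+ 2 in
  (lead_coef F)^-1 *: F.

(* M stands for N_W *)
Definition levenshtein_weight {R : realType} (n r : nat) (M : R)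
    (alpha : 'I_r -> R) (i : 'I_r) : R :=
  let l : {poly R} := \prod_(j < r | j != i) ('X - (alpha j)%:P) in
  (wint (mu_density n) (fun t => l.[t]) - l.[1] / M) / l.[alpha i].

(* Main.v *)
(* The moments of a design are controlled by the functional [L p := int p dmu],
   which is determined by [L 1 = 1] (a Beta integral) and by integration by
   parts, [(n - 1) L(t p) = L((1 - t^2) p')].  From the latter follow the
   three-term recurrence, the norms of the Gegenbauer polynomials P_i and the
   Christoffel-Darboux kernel q_i = sum_(j <= i) r_j P_j at the point 1.

   Counting roots, prod_i (t - alpha_i) = (1 + t)^e T(t), where T is monic of
   degree k, vanishes at s and is orthogonal to all polynomials of degree at most
   k - 2 for (1 - t)(1 + t)^e dmu.  Hence T = a q_k + b P_k for e = 0 and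
   T = a q_k(t) + b (-1)^k q_k(-t) for e = 1, and the equation L_m(n, s) = N_W
   fixes b / a.  The inequality D(n, tau) < N_W then gives the signs of T at 1
   and -1, which place all roots of T in ]-1, 1[ and make the quadrature formula
   with nodes 1 and alpha_i have weight 1 / N_W at 1 and positive weights
   elsewhere.

   The first bound is the value of the quadrature at the Hermite interpolant of
   h, with double nodes except at -1, which lies below h by Rolle's theorem; the
   second is positivity of the weights. *)

(* Only [L 1 = 1], integration by parts and positivity are taken from analysis; the facts about
   Gegenbauer polynomials are then algebra for an abstract functional. In dimension 2 the density is
   unbounded at both endpoints, so integrals are computed as limits over closed intervals exhausting
   the open one.

   The equation L_m(n, s) = N_W is the condition T(s) = 0 in disguise. For e = 0 the
   Christoffel-Darboux formula gives L_m(n, s) = q_k(1) - q_k(s) / P_k(s), so T = a q_k + b P_k has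
   b = a (N_W - q_k(1)), where a = L T. Hence T(1) = N_W L T, which is the weight 1 / N_W at the
   node 1, and (-1)^k T(-1) = a (N_W - D(n, tau)): the bound D is the value of N_W at which T would
   vanish at -1. For e = 1 one has D(n, tau) = q_k(1), and b is a positive multiple of a (N_W - D(n,
   tau)).

   Polynomials defined by choice default to 0 and division by zero gives 0, so the existence of the
   former and the nonvanishing of the denominators of L_m have to be recovered on the way. *)
Require Import Defs.
From mathcomp Require Import measurable_realfun zify ring lra.

Set Implicit Arguments.
Unset Strict Implicit.
Unset Printing Implicit Defensive.

Import Order.TTheory GRing.Theory Num.Theory.
Import numFieldNormedType.Exports.

Local Open Scope classical_set_scope.
Local Open Scope ring_scope.

(** * Integration over exhaustions and the Gamma function *)

Section exhaustion.
Context {R : realType}.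
Local Notation mu := (@lebesgue_measure R).
Variables (a b : nat -> R) (J : set R).
Hypotheses (nia : nonincreasing_seq a) (ndb : nondecreasing_seq b).
Hypothesis JE : \bigcup_m `[a m, b m]%classic = J.

Let ndI : nondecreasing_seq (fun m => `[a m, b m]%classic).
Proof.
move=> i j ij; rewrite subsetEset => x /=; rewrite !in_itv/= => /andP[ax xb].
by rewrite (le_trans (nia ij) ax) (le_trans xb (ndb ij)).
Qed.

Let IJ m : `[a m, b m]%classic `<=` J.
Proof. by move=> x Ix; rewrite -JE; exists m. Qed.

Let mJ : measurable J.
Proof. by rewrite -JE; exact: bigcup_measurable. Qed.

Lemma continuous_exhaustion_measurable (f : R -> R) :
  (forall x, J x -> {for x, continuous f}) -> measurable_fun J f.
Proof.
move=> cf; rewrite -JE; apply/measurable_fun_bigcup => // m.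
apply: subspace_continuous_measurable_fun => //.
by apply: continuous_in_subspaceT => x; rewrite inE => /IJ /cf.
Qed.

Lemma continuous_exhaustion_integrable (f : R -> R) m :
  (forall x, J x -> {for x, continuous f}) ->
  mu.-integrable `[a m, b m] (EFin \o f).
Proof.
move=> cf; apply: continuous_compact_integrable; first exact: segment_compact.
by apply: continuous_in_subspaceT => x; rewrite inE => /IJ /cf.
Qed.

Lemma ge0_cvg_integral_exhaustion (f : R -> \bar R) :
  measurable_fun J f -> (forall x, J x -> 0 <= f x)%E ->
  (\int[mu]_(x in `[a m, b m]) f x)%E @[m --> \oo]
    --> (\int[mu]_(x in J) f x)%E.
Proof.
move=> mf f0; have := @ge0_nondecreasing_set_cvg_integral _ (measurableTypeR R) R
  (fun m => `[a m, b m]%classic) f (@lebesgue_measure R) ndI.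
rewrite JE; apply => //.
- by move=> m; exact: measurable_funS mf.
- by move=> m x /IJ xJ; rewrite f0.
Qed.

(** Integrability is a consequence, not an assumption: the truncated integrals are finite by
    compactness, so their real limit is also the limit in the extended reals given by monotone
    convergence. *)
Lemma ge0_integral_exhaustion (f : R -> R) (l : R) :
  (forall x, J x -> {for x, continuous f}) -> (forall x, J x -> 0 <= f x) ->
  \int[mu]_(x in `[a m, b m]) f x @[m --> \oo] --> l ->
  (\int[mu]_(x in J) (f x)%:E)%E = l%:E.
Proof.
move=> cf f0 fl.
have mf : measurable_fun J (EFin \o f).
  by apply/measurable_EFinP; exact: continuous_exhaustion_measurable.
have /cvg_lim <- // := ge0_cvg_integral_exhaustion mf f0.
apply/cvg_lim => //.
apply: cvg_EFin; last exact: fl.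
near=> m; apply: integrable_fin_num => //.
exact: continuous_exhaustion_integrable.
Unshelve. all: by end_near. Qed.

(** Monotone convergence is applied to the positive and the negative part separately. *)
Lemma cvg_integral_exhaustion (f : R -> R) :
  mu.-integrable J (EFin \o f) ->
  \int[mu]_(x in `[a m, b m]) f x @[m --> \oo] --> \int[mu]_(x in J) f x.
Proof.
move=> fi.
have key (g : R -> \bar R) : mu.-integrable J g -> (forall x, J x -> 0 <= g x)%E ->
    fine (\int[mu]_(x in `[a m, b m]) g x)%E @[m --> \oo]
      --> fine (\int[mu]_(x in J) g x)%E.
  move=> gi g0; apply: fine_cvg; rewrite fineK ?integrable_fin_num//.
  by apply: ge0_cvg_integral_exhaustion => //; exact: measurable_int gi.
have fiI m : mu.-integrable `[a m, b m] (EFin \o f).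
  by apply: integrableS fi => //; exact: IJ.
rewrite /Rintegral [X in _ --> X](_ : _ =
    fine (\int[mu]_(x in J) ((EFin \o f)^\+ x))%E -
    fine (\int[mu]_(x in J) ((EFin \o f)^\- x))%E); last first.
  rewrite [in LHS]integralE fineB ?integrable_fin_num//.
    exact: integrable_funepos. exact: integrable_funeneg.
rewrite [X in X @ _ --> _](_ : _ = (fun m =>
    fine (\int[mu]_(x in `[a m, b m]) ((EFin \o f)^\+ x))%E -
    fine (\int[mu]_(x in `[a m, b m]) ((EFin \o f)^\- x))%E)); last first.
  apply/funext => m; rewrite [in LHS]integralE fineB ?integrable_fin_num//.
    exact: integrable_funepos. exact: integrable_funeneg.
apply: cvgB; apply: key.
- exact: integrable_funepos.
- by move=> x _; exact: funepos_ge0.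
- exact: integrable_funeneg.
- by move=> x _; exact: funeneg_ge0.
Qed.

Lemma FTC_exhaustion (f F : R -> R) m : a m < b m ->
  (forall x, J x -> {for x, continuous f}) ->
  (forall x, J x -> is_derive x 1 F (f x)) ->
  \int[mu]_(x in `[a m, b m]) f x = F (b m) - F (a m).
Proof.
move=> ab cf dF; rewrite /Rintegral (@continuous_FTC2 _ f F)//.
- by apply: continuous_in_subspaceT => x; rewrite inE => /IJ /cf.
- have cF x : J x -> {for x, continuous F}.
    by move=> /dF [d _]; apply/differentiable_continuous/derivable1_diffP.
  split.
  + by move=> x xab; have [] := dF x (IJ (subset_itv_oo_cc xab)).
  + apply: cvg_at_right_filter; apply: cF; apply: (@IJ m) => /=.
    by rewrite in_itv/= lexx ltW.
  + apply: cvg_at_left_filter; apply: cF; apply: (@IJ m) => /=.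
    by rewrite in_itv/= lexx ltW.
- by move=> x xab; have [_ <-] := dF x (IJ (subset_itv_oo_cc xab)); rewrite derive1E.
Qed.

End exhaustion.

(** * The Gamma function at half-integers *)

Section gamma_function.
Context {R : realType}.
Local Notation mu := (@lebesgue_measure R).

Let a (m : nat) : R := m.+2%:R^-1.
Let b (m : nat) : R := m.+2%:R.

Let nia : nonincreasing_seq a.
Proof. by move=> i j ij; rewrite /a lef_pV2 ?posrE// ler_nat !ltnS. Qed.

Let ndb : nondecreasing_seq b.
Proof. by move=> i j ij; rewrite /b ler_nat !ltnS. Qed.

Let ab m : a m < b m.
Proof. by rewrite /a /b (@lt_trans _ _ 1)// ?invf_lt1 ?ltr1n. Qed.

Let JE : \bigcup_m `[a m, b m]%classic = `]0, +oo[%classic.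
Proof.
apply/seteqP; split=> x /=.
  by case=> m _ /=; rewrite !in_itv/= andbT => /andP[+ _]; apply: lt_le_trans; rewrite /a.
rewrite in_itv/= andbT => x0; near \oo => m; exists m => //=.
rewrite in_itv/= /a /b; apply/andP; split.
  rewrite -[leRHS]invrK lef_pV2 ?posrE ?invr_gt0//.
  by apply: (@le_trans _ _ m%:R); [near: m; exact: nbhs_infty_ger|rewrite ler_nat ltnW].
by apply: (@le_trans _ _ m%:R); [near: m; exact: nbhs_infty_ger|rewrite ler_nat ltnW].
Unshelve. all: by end_near. Qed.

Let a_cvg0 : a m @[m --> \oo] --> 0^'+.
Proof.
have a0 : a m @[m --> \oo] --> 0.
  by have := @cvg_harmonic R; rewrite -(cvg_shiftS (@harmonic R)).
move=> P P0; have : nbhs (0 : R) (fun y => 0 < y -> P y) by exact: P0.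
move=> /a0 [M _ hM]; exists M => // m /hM; apply.
by rewrite /a invr_gt0 ltr0n.
Qed.

Lemma is_derive_powR_expRN (x t : R) : 0 < t ->
  is_derive t 1 (fun t : R => t `^ x * expR (- t))
    (x * (t `^ (x - 1) * expR (- t)) - t `^ x * expR (- t)).
Proof.
move=> t0; have dp := is_derive1_powR x t0.
have de : is_derive t 1 (fun t : R => expR (- t)) (- expR (- t)).
  by apply: is_derive_eq; rewrite mulrN1.
by apply: is_derive_eq; rewrite /GRing.scale/=; ring.
Qed.

Lemma continuous_powR_expRN (x t : R) : 0 < t ->
  {for t, continuous (fun t : R => t `^ x * expR (- t))}.
Proof.
move=> /(is_derive_powR_expRN x)[d _].
exact/differentiable_continuous/derivable1_diffP.
Qed.

(** With [K - 1 > |x|], the bounds [t^x <= t^(K-1)] and [(t/K)^K <= e^t] give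
    [t^x e^(-t) <= K^K / t]. The second bound is the K-th power of [t/K <= e^(t/K)]. *)
Lemma cvg_powR_expRN_pinfty (x : R) :
  m.+2%:R `^ x * expR (- m.+2%:R) @[m --> \oo] --> (0 : R).
Proof.
pose K := (Num.truncn `|x|).+2.
apply: (@squeeze_cvgr _ _ _ _ (cst 0) (fun m => K%:R ^+ K * m.+1%:R^-1)).
- apply: nearW => m; rewrite mulr_ge0 ?powR_ge0 ?expR_ge0//=.
  set t : R := m.+2%:R; have t0 : 0 < t by rewrite ltr0n.
  have K0 : 0 < K%:R :> R by rewrite ltr0n.
  have tx : t `^ x <= t ^+ K.-1.
    rewrite -powR_mulrn ?(ltW t0)//; apply: ler_powR; first by rewrite ler1n.
    by rewrite (le_trans (ler_norm x))//; apply: ltW; exact: truncnS_gt.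
  have te : (t / K%:R) ^+ K <= expR t.
    rewrite -[in leRHS](divfK (lt0r_neq0 K0) t) expRM_natr.
    have tK : 0 <= t / K%:R by rewrite divr_ge0 ?(ltW t0) ?(ltW K0).
    apply: lerXn2r; rewrite ?nnegrE ?expR_ge0//.
    by rewrite (le_trans _ (expR_ge1Dx _))// lerDr.
  rewrite expRN; apply: (@le_trans _ _ (t ^+ K.-1 / ((t / K%:R) ^+ K))).
    by rewrite ler_pM ?powR_ge0 ?invr_ge0 ?expR_ge0// lef_pV2 ?posrE ?expR_gt0 ?exprn_gt0 ?divr_gt0.
  have tn0 := lt0r_neq0 t0.
  have -> : t ^+ K.-1 / (t / K%:R) ^+ K = K%:R ^+ K / t.
    rewrite expr_div_n (exprS t K.-1); field.
    by rewrite !expf_neq0// lt0r_neq0.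
  by rewrite ler_pM2l ?exprn_gt0// /t lef_pV2 ?posrE// ler_nat.
- exact: cvg_cst.
- rewrite -[X in _ --> X](mulr0 (K%:R ^+ K)); apply: cvgMr.
  exact: (@cvg_harmonic R).
Qed.

(** The functional equation of Gamma, by parts. It is stated for the extended integral so that
    finiteness is passed on together with the value. *)
Lemma Gamma_integralD1 (x G : R) : 0 < x ->
  (\int[mu]_(t in `]0%R, +oo[) (t `^ (x - 1) * expR (- t))%:E)%E = G%:E ->
  (\int[mu]_(t in `]0%R, +oo[) (t `^ x * expR (- t))%:E)%E = (x * G)%:E.
Proof.
move=> x0 IG.
have J0 (t : R) : `]0, +oo[%classic t -> 0 < t by rewrite /= in_itv/= andbT.
have c (y t : R) : `]0, +oo[%classic t ->
  {for t, continuous (fun t : R => t `^ y * expR (- t))}.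
  by move=> /J0 t0; exact: continuous_powR_expRN.
have iy y m := continuous_exhaustion_integrable JE m (c y).
have iJ : mu.-integrable `]0, +oo[ (EFin \o (fun t : R => t `^ (x - 1) * expR (- t))).
  apply/integrableP; split.
    apply/measurable_EFinP; exact: (continuous_exhaustion_measurable JE (c _)).
  under eq_integral do rewrite /= ger0_norm ?mulr_ge0 ?powR_ge0 ?expR_ge0//.
  by rewrite IG ltry.
apply: (ge0_integral_exhaustion nia ndb JE); first exact: c.
  by move=> t _; rewrite mulr_ge0 ?powR_ge0 ?expR_ge0.
pose f t : R := x * (t `^ (x - 1) * expR (- t)) - t `^ x * expR (- t).
have cf (t : R) : `]0, +oo[%classic t -> {for t, continuous f}.
  move=> tJ; apply: cvgB; last exact: c.
  by apply: cvgM; [exact: cvg_cst|exact: c].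
have df (t : R) : `]0, +oo[%classic t ->
    is_derive t 1 (fun t : R => t `^ x * expR (- t)) (f t).
  by move=> /J0; exact: is_derive_powR_expRN.
have E m : \int[mu]_(t in `[a m, b m]) (t `^ x * expR (- t)) =
    x * \int[mu]_(t in `[a m, b m]) (t `^ (x - 1) * expR (- t)) -
    (b m `^ x * expR (- b m) - a m `^ x * expR (- a m)).
  have <- := FTC_exhaustion JE (ab m) cf df.
  rewrite RintegralB//; last first.
    pose g t : R := t `^ (x - 1) * expR (- t).
    have -> : (EFin \o (fun t => x * g t)) = (fun t => x%:E * (EFin \o g) t)%E by [].
    by apply: integrableZl; [exact: measurable_itv|exact: iy].
  by rewrite RintegralZl// opprB addrC subrK.
rewrite [X in X @ _ --> _](funext E).
rewrite -[X in _ --> X]subr0; apply: cvgB.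
  apply: cvgM; first exact: cvg_cst.
  have := cvg_integral_exhaustion nia ndb JE iJ.
  by rewrite {2}/Rintegral IG.
rewrite -[X in _ --> X]subr0; apply: cvgB; first exact: cvg_powR_expRN_pinfty.
rewrite -[X in _ --> X](mul0r (expR (- 0))); apply: cvgM.
  exact: (cvg_comp _ _ a_cvg0 (powR_cvg0 x0)).
have a0 : a m @[m --> \oo] --> (0 : R) by exact: cvg_trans a_cvg0 (cvg_within _).
have ce : expR (- t) @[t --> (0 : R)] --> expR (- (0 : R)).
  by apply: continuous_comp; [exact: opp_continuous|exact: continuous_expR].
exact: (cvg_comp _ _ a0 ce).
Qed.

Lemma Gamma_integral1 :
  (\int[mu]_(t in `]0%R, +oo[) (t `^ 0 * expR (- t))%:E)%E = (1 : R)%:E.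
Proof.
have J0 (t : R) : `]0, +oo[%classic t -> 0 < t by rewrite /= in_itv/= andbT.
have c (t : R) : `]0, +oo[%classic t ->
    {for t, continuous (fun t : R => t `^ 0 * expR (- t))}.
  by move=> /J0 t0; exact: continuous_powR_expRN.
apply: (ge0_integral_exhaustion nia ndb JE) => //.
  by move=> t _; rewrite mulr_ge0 ?powR_ge0 ?expR_ge0.
have df (t : R) : `]0, +oo[%classic t ->
    is_derive t 1 (fun t : R => - expR (- t)) (t `^ 0 * expR (- t)).
  by move=> _; apply: is_derive_eq; rewrite powRr0 mulrN1 opprK mul1r.
rewrite [X in X @ _ --> _](funext (fun m => FTC_exhaustion JE (ab m) c df)).
rewrite [X in X @ _ --> _](_ : _ = (fun m => expR (- a m) - expR (- b m))); last first.
  by apply/funext => m; rewrite opprK addrC.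
rewrite -[X in _ --> X]subr0; apply: cvgB.
  rewrite -[X in _ --> X]expR0 -oppr0.
  have a0 : a m @[m --> \oo] --> (0 : R) by exact: cvg_trans a_cvg0 (cvg_within _).
  have ce : expR (- t) @[t --> (0 : R)] --> expR (- (0 : R)).
    by apply: continuous_comp; [exact: opp_continuous|exact: continuous_expR].
  exact: (cvg_comp _ _ a0 ce).
have := cvg_powR_expRN_pinfty 0.
by under eq_fun do rewrite powRr0 mul1r.
Qed.

(** The substitution [t = u^2] leads to the Gauss integral; hence the exhaustion by squares of the
    usual endpoints. *)
Lemma Gamma_integral_half :
  (\int[mu]_(t in `]0%R, +oo[) (t `^ (- 2^-1) * expR (- t))%:E)%E = (Num.sqrt pi : R)%:E.
Proof.
have J0 (t : R) : `]0, +oo[%classic t -> 0 < t by rewrite /= in_itv/= andbT.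
have c (t : R) : `]0, +oo[%classic t ->
    {for t, continuous (fun t : R => t `^ (- 2^-1) * expR (- t))}.
  by move=> /J0 t0; exact: continuous_powR_expRN.
have a2b2 : \bigcup_m `[a m ^+ 2, b m ^+ 2]%classic = `]0, +oo[%classic.
  have a0 m : 0 <= a m by rewrite /a.
  have b0 m : 0 <= b m by rewrite /b.
  apply/seteqP; split=> x /=.
    case=> m _ /=; rewrite !in_itv/= andbT => /andP[+ _]; apply: lt_le_trans.
    by rewrite exprn_gt0// /a.
  rewrite in_itv/= andbT => x0.
  have : (\bigcup_m `[a m, b m]%classic) (Num.sqrt x).
    by rewrite JE /= in_itv/= andbT sqrtr_gt0.
  case=> m _ /=; rewrite in_itv/= => /andP[ax xb]; exists m => //=.
  rewrite in_itv/= -(sqr_sqrtr (ltW x0)) !ler_pXn2r ?ax// ?nnegrE ?sqrtr_ge0//.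
have ig : mu.-integrable `]0, +oo[ (EFin \o (@gauss_fun R)).
  exact: integrableS (@integrableT_gauss R).
apply: (@ge0_integral_exhaustion _ (fun m => a m ^+ 2) (fun m => b m ^+ 2)) => //.
- by move=> i j ij; rewrite ler_pXn2r ?nnegrE ?nia// /a.
- by move=> i j ij; rewrite ler_pXn2r ?nnegrE ?ndb// /b.
- by move=> t _; rewrite mulr_ge0 ?powR_ge0 ?expR_ge0.
have dsq (x : R) : is_derive x 1 (fun t : R => t ^+ 2) (2 * x).
  by apply: is_derive_eq; rewrite /GRing.scale/=; ring.
have sq' : (fun t : R => t ^+ 2)^`()%classic = (fun x => 2 * x).
  by apply/funext => x; have [_ <-] := dsq x; rewrite derive1E.
have csq' x : {for x, continuous (fun x : R => 2 * x)} by exact: mulrl_continuous.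
have csq x : {for x, continuous (fun x : R => x ^+ 2)} by exact: exprn_continuous.
have E m : \int[mu]_(t in `[a m ^+ 2, b m ^+ 2]) (t `^ (- 2^-1) * expR (- t))
   = 2 * \int[mu]_(t in `[a m, b m]) gauss_fun t.
  have a0 : 0 < a m by rewrite /a.
  rewrite {1}/Rintegral (@integration_by_substitution_increasing _ (fun t => t ^+ 2)).
  - rewrite sq' -RintegralZl//; last exact: (integrableS _ _ _ (@integrableT_gauss R)).
    congr fine; apply: eq_integral => t; rewrite inE/= in_itv/= => /andP[am _].
    have t0 := lt_le_trans a0 am.
    congr EFin; change ((t ^+ 2) `^ (- 2^-1) * expR (- t ^+ 2) * (2 * t) = 2 * gauss_fun t).
    rewrite /gauss_fun -{1}(powR_mulrn 2 (ltW t0)) -powRrM mulrN mulfV// (powR_inv1 (ltW t0)).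
    by field; exact: lt0r_neq0.
  - exact: ltW.
  - move=> x y; rewrite !in_itv/= => /andP[ax _] /andP[ay _] xy.
    by rewrite ltr_pXn2r// ?nnegrE ltW// (lt_le_trans a0).
  - by rewrite sq' => x _; exact: csq'.
  - rewrite sq'; apply/cvg_ex; exists (2 * a m); apply: cvg_at_right_filter; exact: csq'.
  - rewrite sq'; apply/cvg_ex; exists (2 * b m); apply: cvg_at_left_filter; exact: csq'.
  - split.
    + by move=> x _; have [] := dsq x.
    + by apply: cvg_at_right_filter; exact: csq.
    + by apply: cvg_at_left_filter; exact: csq.
  - apply: continuous_in_subspaceT => t; rewrite inE/= in_itv/= => /andP[at_ _].
    by apply: c => /=; rewrite in_itv/= andbT (lt_le_trans _ at_)// exprn_gt0.
rewrite [X in X @ _ --> _](funext E).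
rewrite [X in _ --> X](_ : _ = 2 * \int[mu]_(t in `]0, +oo[) gauss_fun t); last first.
  rewrite /Rintegral integral_itv_obnd_cbnd//; last first.
    by apply/measurable_EFinP/measurable_funTS; exact: measurable_gauss_fun.
  by rewrite integral0y_gauss/=; field.
apply: cvgM; first exact: cvg_cst.
exact: (cvg_integral_exhaustion nia ndb JE).
Qed.

(** [Gamma] is the real part of an integral and would be 0 if that integral were infinite.
    Finiteness follows in steps of two from the arguments 1/2 and 1. *)
Lemma Gamma_half_integral n : (0 < n)%N ->
  (\int[mu]_(t in `]0%R, +oo[) (t `^ (n%:R / 2 - 1) * expR (- t))%:E)%E
    = (Gamma (n%:R / 2) : R)%:E.
Proof.
move=> n0; suff [g Eg] : exists g : R,
    (\int[mu]_(t in `]0%R, +oo[) (t `^ (n%:R / 2 - 1) * expR (- t))%:E)%E = g%:E.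
  by rewrite /Gamma /Rintegral Eg.
elim/ltn_ind: n n0 => -[//|[|[|n]]] IH _.
- exists (Num.sqrt pi); rewrite -Gamma_integral_half.
  by rewrite (_ : 1 / 2 - 1 = - 2^-1 :> R)//; field.
- by exists 1; rewrite -Gamma_integral1 divff// subrr.
have [g Eg] := IH n.+1 (leqW (leqnn _)) isT.
exists (n.+1%:R / 2 * g).
have -> : n.+3%:R / 2 - 1 = n.+1%:R / 2 :> R by have -> : n.+3%:R = n.+1%:R + 2 :> R by [rewrite -natrD addn2]; field.
by apply: Gamma_integralD1 => //; rewrite divr_gt0.
Qed.

Lemma Gamma1 : Gamma (2%:R / 2) = 1 :> R.
Proof.
apply: EFin_inj; rewrite -Gamma_half_integral// -Gamma_integral1.
by rewrite divff// subrr.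
Qed.

Lemma Gamma_half : Gamma (1%:R / 2) = Num.sqrt pi :> R.
Proof.
apply: EFin_inj; rewrite -Gamma_half_integral// -Gamma_integral_half.
by rewrite (_ : 1%:R / 2 - 1 = - 2^-1 :> R)//; field.
Qed.

Lemma Gamma_halfD1 n : (0 < n)%N ->
  Gamma (n.+2%:R / 2) = n%:R / 2 * Gamma (n%:R / 2) :> R.
Proof.
move=> n0; apply: EFin_inj; rewrite -Gamma_half_integral//.
have -> : n.+2%:R / 2 - 1 = n%:R / 2 :> R by have -> : n.+2%:R = n%:R + 2 :> R by [rewrite -natrD addn2]; field.
by apply: Gamma_integralD1; [rewrite divr_gt0// ltr0n|exact: Gamma_half_integral].
Qed.

End gamma_function.

(** * The functional of the ultraspherical measure *)

Section ultraspherical_integral.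
Context {R : realType}.
Local Notation mu := (@lebesgue_measure R).

Let b (m : nat) : R := 1 - m.+2%:R^-1.
Let a (m : nat) : R := - b m.

Let b01 m : 0 < b m < 1.
Proof.
by rewrite subr_gt0 invf_lt1 ?ltr1n//= ltrBlDr ltrDl invr_gt0 ltr0n.
Qed.

Let ndb : nondecreasing_seq b.
Proof. by move=> i j ij; rewrite /b lerB// lef_pV2 ?posrE// ler_nat !ltnS. Qed.

Let nia : nonincreasing_seq a.
Proof. by move=> i j /ndb; rewrite lerN2. Qed.

Let ab m : a m < b m.
Proof. by have /andP[b0 _] := b01 m; rewrite gtrN. Qed.

Let b_cvg1 : b m @[m --> \oo] --> (1 : R).
Proof.
rewrite -[X in _ --> X]subr0; apply: cvgB; first exact: cvg_cst.
by have := @cvg_harmonic R; rewrite -(cvg_shiftS (@harmonic R)).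
Qed.

Let a_cvgN1 : a m @[m --> \oo] --> (-1 : R).
Proof. exact: cvgN. Qed.

Let J0 (t : R) : `]-1, 1[%classic t -> 0 < 1 - t ^+ 2.
Proof.
rewrite /= in_itv/= => /andP[t1 t2].
by rewrite -[X in X - _](expr1n _ 2) subr_sqr mulr_gt0 ?subr_gt0// -ltrBlDl sub0r.
Qed.

Let JE : \bigcup_m `[a m, b m]%classic = `]-1, 1[%classic.
Proof.
apply/seteqP; split=> x /=.
  case=> m _ /=; rewrite !in_itv/= => /andP[ax xb]; have /andP[_ b1] := b01 m.
  by rewrite (le_lt_trans xb b1) (lt_le_trans _ ax)// ltrN2.
rewrite in_itv/= => /andP[x1 x2].
near \oo => m; exists m => //=; rewrite in_itv/=; apply/andP; split.
  by apply/ltW; near: m; exact: (cvgr_lt (-1 : R)).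
by apply/ltW; near: m; exact: (cvgr_gt (1 : R)).
Unshelve. all: by end_near. Qed.

Lemma is_derive_powR_ball (x t : R) : -1 < t < 1 ->
  is_derive t 1 (fun t : R => (1 - t ^+ 2) `^ x)
    (x * (1 - t ^+ 2) `^ (x - 1) * (- 2 * t)).
Proof.
move=> t1; have t0 : 0 < 1 - t ^+ 2 by apply: J0; rewrite /= in_itv.
have dp := is_derive1_powR x t0.
have d2 : is_derive t 1 (fun t : R => 1 - t ^+ 2) (- 2 * t).
  by apply: is_derive_eq; rewrite /GRing.scale/=; ring.
have H := @is_derive1_comp R (fun y => y `^ x) (fun t => 1 - t ^+ 2) t _ _ dp d2.
exact: H.
Qed.

Lemma continuous_powR_ball (x t : R) : -1 < t < 1 ->
  {for t, continuous (fun t : R => (1 - t ^+ 2) `^ x)}.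
Proof.
move=> /(is_derive_powR_ball x)[d _].
exact/differentiable_continuous/derivable1_diffP.
Qed.

Lemma measurable_powR_ball (x : R) D :
  measurable_fun D (fun t : R => (1 - t ^+ 2) `^ x).
Proof.
have m : measurable_fun setT (fun t : R => (1 - t ^+ 2) `^ x).
  apply: (@measurableT_comp _ _ _ _ _ _ (@powR R ^~ x)) => //.
  by apply: measurable_funB => //; exact: exprn_measurable.
exact: measurable_funTS m.
Qed.

Lemma integral_powR_ball_itv (x : R) :
  (\int[mu]_(t in `](-1)%R, 1%R[) ((1 - t ^+ 2) `^ x)%:E =
   \int[mu]_(t in `[(-1)%R, 1%R]) ((1 - t ^+ 2) `^ x)%:E)%E.
Proof.
have m D : measurable_fun D (EFin \o (fun t : R => (1 - t ^+ 2) `^ x)).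
  by apply/measurable_EFinP; exact: measurable_powR_ball.
by rewrite integral_itv_bndo_bndc// integral_itv_obnd_cbnd.
Qed.

Lemma integral_powR_ball_Nhalf :
  (\int[mu]_(t in `](-1)%R, 1%R[) ((1 - t ^+ 2) `^ (- 2^-1))%:E)%E = (pi : R)%:E.
Proof.
have c (t : R) : `]-1, 1[%classic t ->
  {for t, continuous (fun t : R => (1 - t ^+ 2) `^ (- 2^-1))}.
  by rewrite /= in_itv/=; exact: continuous_powR_ball.
apply: (ge0_integral_exhaustion nia ndb JE c) => [t _|]; first exact: powR_ge0.
have df (t : R) : `]-1, 1[%classic t ->
    is_derive t 1 (- @acos R) ((1 - t ^+ 2) `^ (- 2^-1)).
  move=> tJ; have t2 := J0 tJ; move: tJ; rewrite /= in_itv/= => t1.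
  have da := is_derive1_acos t1.
  by apply: is_derive_eq; rewrite opprK powRN powR12_sqrt// ltW.
rewrite [X in X @ _ --> _](funext (fun m => FTC_exhaustion JE (ab m) c df)).
rewrite [X in X @ _ --> _](_ : _ = (fun m => pi - 2 * acos (b m))); last first.
  apply/funext => m; have /andP[b0 b1] := b01 m.
  rewrite /a !fctE acosN; first by ring.
  by rewrite (ltW b1) (le_trans _ (ltW b0)).
rewrite -[X in _ --> X]subr0; apply: cvgB; first exact: cvg_cst.
rewrite -[X in _ --> X](mulr0 2); apply: cvgM; first exact: cvg_cst.
apply/cvgrPdist_lt => e e0.
(* [acos (b m) < d] is equivalent to [cos d < b m], because cos decreases on [[0, pi]]; the cap
   [pi / 2] keeps [d] in that range. *)
pose d : R := Order.min e (pi / 2).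
have pi0 := @pi_gt0 R.
have d0 : 0 < d by rewrite lt_min e0 divr_gt0.
have dpi : d < pi by rewrite gt_min [X in _ || X](_ : _ = true) ?orbT//; lra.
have cd1 : cos d < 1.
  by rewrite -(@cos0 R) ltr_cos ?in_itv/= ?lexx ?pi_ge0// ltW//= ltW.
near=> m.
have /andP[b0 b1] := b01 m.
have bI : -1 <= b m <= 1 by rewrite (ltW b1) (le_trans _ (ltW b0)).
rewrite sub0r normrN ger0_norm ?acos_ge0//.
rewrite (lt_le_trans (_ : acos (b m) < d)) ?ge_min ?lexx//.
rewrite -ltr_cos ?in_itv/= ?acos_ge0 ?acos_lepi ?(ltW d0) ?(ltW dpi)// acosK ?in_itv//=.
by near: m; exact: (cvgr_gt (1 : R)).
Unshelve. all: by end_near. Qed.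

(** The alternatives are the exponents [(n - 3) / 2] for [n = 2], where the integral is computed,
    and for [n >= 3], where the density is at most 1. *)
Lemma integrable_powR_ball (x : R) : x = - 2^-1 \/ 0 <= x ->
  mu.-integrable `[-1, 1] (EFin \o (fun t : R => (1 - t ^+ 2) `^ x)).
Proof.
case=> [->|x0].
  apply/integrableP; split.
    by apply/measurable_EFinP; exact: measurable_powR_ball.
  under eq_integral do rewrite /= ger0_norm ?powR_ge0//.
  by rewrite -integral_powR_ball_itv integral_powR_ball_Nhalf ltry.
apply: measurable_bounded_integrable.
- exact: measurable_itv.
- by apply: compact_finite_measure; exact: segment_compact.
- exact: measurable_powR_ball.
- exists 1; split; first exact: num_real.
  move=> y y1 t /=; rewrite in_itv/= => /andP[t1 t2].
  rewrite ger0_norm ?powR_ge0//.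
  apply: (@le_trans _ _ (1 `^ x)); last by rewrite powR1 ltW.
  have t21 : t ^+ 2 <= 1 by rewrite -real_normK ?num_real// expr_le1// ler_norml t1.
  apply: ge0_ler_powR => //; rewrite ?nnegrE ?subr_ge0//.
  by rewrite lerBlDr lerDl sqr_ge0.
Qed.

Lemma integrable_horner_powR_ball (p : {poly R}) (x : R) :
  x = - 2^-1 \/ 0 <= x ->
  mu.-integrable `[-1, 1] (EFin \o (fun t : R => p.[t] * (1 - t ^+ 2) `^ x)).
Proof.
move=> hx.
have cp : continuous (horner p).
  by move=> t; exact: continuous_horner.
apply: (@integrableMr _ (measurableTypeR R) R mu _ _ (horner p) (EFin \o (fun t : R => (1 - t ^+ 2) `^ x))).
- exact: measurable_itv.
- by apply: measurable_funTS; exact: continuous_measurable_fun.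
- have := continuous_compact (continuous_subspaceT cp) (@segment_compact R (-1) 1).
  move=> /compact_bounded[M [_ mrt]].
  by exists M; split; rewrite ?num_real // => ? ? ? ?; exact: mrt.
- exact: integrable_powR_ball.
Qed.

(* The integrand is the derivative of [p(t) (1 - t^2)^x], which vanishes at
   both endpoints. *)
Lemma integral_powR_ball_parts (p : {poly R}) (x : R) :
  0 < x -> (x - 1 = - 2^-1 \/ 0 <= x - 1) ->
  \int[mu]_(t in `[-1, 1])
    (((1 - 'X^2) * p^`() - (2 * x) *: ('X * p)).[t] * (1 - t ^+ 2) `^ (x - 1)) = 0.
Proof.
move=> x0 hx; set q := (_ - _ : {poly R}).
pose f t : R := q.[t] * (1 - t ^+ 2) `^ (x - 1).
pose F t : R := p.[t] * (1 - t ^+ 2) `^ x.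
have iq := integrable_horner_powR_ball q hx.
have iJ : mu.-integrable `]-1, 1[ (EFin \o f).
  by apply: integrableS iq => //; exact: subset_itv_oo_cc.
have -> : \int[mu]_(t in `[-1, 1]) f t = \int[mu]_(t in `]-1, 1[) f t.
  rewrite (@Rintegral_itv_bndo_bndc R (BRight (-1)))//.
  rewrite Rintegral_itv_obnd_cbnd//; apply: integrableS iq => //.
  by apply: subset_itvr; rewrite bnd_simp.
have cf (t : R) : `]-1, 1[%classic t -> {for t, continuous f}.
  rewrite /= in_itv/= => t1; apply: cvgM; first exact: continuous_horner.
  exact: continuous_powR_ball.
have df (t : R) : `]-1, 1[%classic t -> is_derive t 1 F (f t).
  move=> tJ; have t0 := J0 tJ; move: tJ; rewrite /= in_itv/= => t1.
  have dp := is_derive_poly p t.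
  have dw := is_derive_powR_ball x t1.
  apply: is_derive_eq.
  rewrite /GRing.scale/= /f /q -(mulr_powRB1 (ltW t0) x0) !(hornerD, hornerN, hornerM, hornerZ, hornerX, hornerXn, hornerC).
  by ring.
have := cvg_integral_exhaustion nia ndb JE iJ.
rewrite [X in X @ _ --> _](funext (fun m => FTC_exhaustion JE (ab m) cf df)).
move=> h; apply: (cvg_unique _ h); first exact: norm_hausdorff.
have wl : (1 - b m ^+ 2) `^ x @[m --> \oo] --> (0 : R).
  have b2 : 1 - b m ^+ 2 @[m --> \oo] --> (0 : R).
    rewrite -[X in _ --> X](subrr 1) -[X in _ --> _ - X](expr1n _ 2).
    apply: cvgB; first exact: cvg_cst.
    exact: (cvg_comp _ _ b_cvg1 (@exprn_continuous _ 2 1)).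
  (* The limit of the power at 0 is one from the right, so the argument must also be seen to stay
     positive. *)
  suff b2' : 1 - b m ^+ 2 @[m --> \oo] --> (0 : R)^'+ by exact: (cvg_comp _ _ b2' (powR_cvg0 x0)).
  move=> P P0; have : nbhs (0 : R) (fun y => 0 < y -> P y) by exact: P0.
  move=> /b2 [M _ hM]; exists M => // m /hM; apply.
  apply: J0; rewrite /= in_itv/=; have /andP[b0 ->] := b01 m.
  by rewrite (lt_trans _ b0).
change (F (b m) - F (a m) @[m --> \oo] --> (0 : R)).
rewrite -[X in _ --> X](subrr (0 : R)); apply: cvgB.
  rewrite -[X in _ --> X](mulr0 p.[1]); apply: cvgM => //.
  exact: (cvg_comp _ _ b_cvg1 (@continuous_horner _ p 1)).
rewrite -[X in _ --> X](mulr0 p.[-1]); apply: cvgM.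
  exact: (cvg_comp _ _ a_cvgN1 (@continuous_horner _ p (-1))).
by under eq_fun do rewrite sqrrN.
Qed.

Lemma powR_ball_nat n : (2 <= n)%N ->
  (n%:R - 3) / 2 = - 2^-1 :> R \/ 0 <= (n%:R - 3) / 2 :> R.
Proof.
rewrite leq_eqVlt => /predU1P[<-|n3]; [left; lra|right].
by rewrite divr_ge0// subr_ge0 ler_nat.
Qed.

End ultraspherical_integral.

(** * Normalization, integration by parts and positivity of the functional *)

Section mu_integral.
Context {R : realType}.
Local Notation mu := (@lebesgue_measure R).

(** Left without its Gamma factor, which [mu_density_ball] identifies as the inverse of the total
    mass. *)
Definition ball_integral (n : nat) (p : {poly R}) : R :=
  \int[mu]_(t in `[-1, 1]) (p.[t] * (1 - t ^+ 2) `^ ((n%:R - 3) / 2)).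

Lemma ball_integral2 : ball_integral 2 1 = pi.
Proof.
rewrite /ball_integral (_ : (2%:R - 3) / 2 = - 2^-1); last by field.
under eq_Rintegral do rewrite hornerC mul1r.
by rewrite /Rintegral -integral_powR_ball_itv integral_powR_ball_Nhalf.
Qed.

Lemma ball_integral3 : ball_integral 3 1 = 2.
Proof.
rewrite /ball_integral subrr mul0r.
under eq_Rintegral do rewrite hornerC powRr0 mul1r.
rewrite Rintegral_cst; last exact: measurable_itv.
have := lebesgue_measure_itv `[(-1 : R), 1]; rewrite /= lte_fin (_ : (-1 < 1 :> R) = true); last by apply/idP; lra.
by rewrite mul1r => ->; rewrite /= opprK.
Qed.

Section fixed_dimension.
Variables (n : nat) (n2 : (2 <= n)%N).

Let hn := @powR_ball_nat R n n2.

Lemma ball_integrable (p : {poly R}) : mu.-integrable `[-1, 1]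
  (EFin \o (fun t : R => p.[t] * (1 - t ^+ 2) `^ ((n%:R - 3) / 2))).
Proof. exact: integrable_horner_powR_ball. Qed.

Lemma ball_integralD (p q : {poly R}) :
  ball_integral n (p + q) = ball_integral n p + ball_integral n q.
Proof.
rewrite /ball_integral -RintegralD//; last 2 first.
- exact: ball_integrable.
- exact: ball_integrable.
by apply: eq_Rintegral => t _; rewrite hornerD mulrDl.
Qed.

Lemma ball_integralZ c (p : {poly R}) :
  ball_integral n (c *: p) = c * ball_integral n p.
Proof.
rewrite /ball_integral -RintegralZl//; last exact: ball_integrable.
by apply: eq_Rintegral => t _; rewrite hornerZ mulrA.
Qed.

Lemma ball_integral_parts (p : {poly R}) :
  ball_integral n ((1 - 'X^2) * p^`()) = (n%:R - 1) * ball_integral n ('X * p).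
Proof.
pose x : R := (n%:R - 1) / 2.
have x0 : 0 < x by rewrite divr_gt0// subr_gt0 ltr1n.
have xE : x - 1 = (n%:R - 3) / 2 by rewrite /x; field.
have := @integral_powR_ball_parts R p x x0; rewrite xE => /(_ hn).
rewrite -/(ball_integral n _) -scaleNr ball_integralD ball_integralZ.
rewrite (_ : - (2 * x) = - (n%:R - 1)); last by rewrite /x; field.
by rewrite mulNr => /eqP; rewrite subr_eq0 => /eqP.
Qed.

(** Passing from dimension n to n + 2 multiplies the density by [1 - t^2], and integration by parts
    for [p = t] expresses the integral of [1 - t^2] by that of [t^2]. *)
Lemma ball_integralD2 :
  n%:R * ball_integral n.+2 1 = (n%:R - 1) * ball_integral n 1.
Proof.
pose x : R := (n%:R - 1) / 2.
have x0 : 0 < x by rewrite divr_gt0// subr_gt0 ltr1n.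
have xE : x - 1 = (n%:R - 3) / 2 by rewrite /x; field.
have -> : ball_integral n.+2 1 = ball_integral n (1 - 'X^2).
  apply: eq_Rintegral => t; rewrite inE/= in_itv/= => /andP[t1 t2].
  have -> : (n.+2%:R - 3) / 2 = x.
    by rewrite /x (_ : n.+2%:R = n%:R + 2); [field|rewrite -natrD addn2].
  rewrite !(hornerD, hornerN, hornerXn, hornerC) -xE mulr_powRB1// ?mul1r//.
  by rewrite subr_ge0 -real_normK ?num_real// expr_le1// ler_norml t1.
have := ball_integral_parts 'X; rewrite derivX mulr1 -expr2 => E.
rewrite -ball_integralZ (_ : n%:R *: (1 - 'X^2) =
   (1 - 'X^2) + (1 - n%:R) *: 'X^2 + (n%:R - 1) *: 1); last first.
  by rewrite !scalerBr !scalerBl !scale1r -!mul_polyC; ring.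
move: (1 - 'X^2) E => q E.
by rewrite !ball_integralD !ball_integralZ E; ring.
Qed.

Lemma exists_nonroot_itv (p : {poly R}) : p != 0 ->
  exists2 t : R, -1 < t < 1 & p.[t] != 0.
Proof.
move=> p0; pose rs : seq R := [seq i.+2%:R^-1 | i <- iota 0 (size p)].
have urs : uniq rs.
  rewrite map_inj_uniq ?iota_uniq// => i j /invr_inj /eqP.
  by rewrite eqr_nat !eqSS => /eqP.
have : ~~ all (root p) rs.
  apply/negP => /(max_poly_roots p0)/(_ urs).
  by rewrite size_map size_iota ltnn.
case/allPn => t /mapP[i _ ->] nr; exists i.+2%:R^-1 => //.
by rewrite invf_lt1 ?ltr1n// andbT (lt_trans (_ : -1 < 0)) ?invr_gt0 ?ltrN10.
Qed.

Lemma ball_integral_gt0 (p : {poly R}) : p != 0 ->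
  (forall t, -1 < t < 1 -> 0 <= p.[t]) -> 0 < ball_integral n p.
Proof.
move=> p0 pge0.
have [t0 t01 pt0] := exists_nonroot_itv p0.
pose f t : R := p.[t] * (1 - t ^+ 2) `^ ((n%:R - 3) / 2).
have f0 t : -1 < t < 1 -> 0 <= f t by move=> ?; rewrite mulr_ge0 ?pge0 ?powR_ge0.
have ft0 : 0 < f t0.
  rewrite mulr_gt0 ?lt_def ?pt0 ?pge0 ?powR_ge0// powR_eq0 negb_and.
  by rewrite subr_eq0 eq_sym sqrf_eq1; lra.
have cf : {for t0, continuous f}.
  by apply: cvgM; [exact: continuous_horner|exact: continuous_powR_ball].
have : \forall t \near t0, f t0 / 2 < f t.
  by apply: (cvgr_gt _ cf); lra.
have : \forall t \near t0, t \in `](-1)%R, 1%R[.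
  by apply: near_in_itvoo; rewrite in_itv.
move=> /filterI /[apply] /nbhs_ballP[e /= e0 he].
(* Halving the radius makes the closed interval fit into the open ball on which [f] exceeds
   [f t0 / 2]. *)
pose c := t0 - e / 2; pose d := t0 + e / 2.
have cd t : t \in `[c, d] -> (t \in `](-1)%R, 1%R[) /\ f t0 / 2 < f t.
  rewrite in_itv/= /c /d => ct; apply: he.
  by rewrite /ball/= distrC ltr_norml; lra.
have iJ : mu.-integrable `]-1, 1[ (EFin \o f).
  by apply: integrableS (ball_integrable p) => //; exact: subset_itv_oo_cc.
have sub : `[c, d]%classic `<=` `](-1)%R, 1%R[%classic.
  by move=> t tcd; have [] := cd t tcd.
have icd : mu.-integrable `[c, d] (EFin \o f) by exact: integrableS iJ.
have -> : ball_integral n p = \int[mu]_(t in `]-1, 1[) f t.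
  rewrite /ball_integral (@Rintegral_itv_bndo_bndc R (BRight (-1)))//.
  rewrite Rintegral_itv_obnd_cbnd//; apply: integrableS (ball_integrable p) => //.
  by apply: subset_itvr; rewrite bnd_simp.
apply: (@lt_le_trans _ _ (\int[mu]_(t in `[c, d]) f t)); last first.
  apply: fine_le; rewrite ?integrable_fin_num//.
  by apply: ge0_subset_integral => //; exact: measurable_int iJ.
apply: (@lt_le_trans _ _ (\int[mu]_(t in `[c, d]) (f t0 / 2))); last first.
  apply: le_Rintegral => //.
    by apply: continuous_compact_integrable; [exact: segment_compact|move=> ?; exact: cvg_cst].
  by move=> t /cd[_ /ltW].
rewrite Rintegral_cst; last exact: measurable_itv.
have := lebesgue_measure_itv `[c, d]; rewrite /= lte_fin (_ : (c < d) = true); last first.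
  by apply/idP; rewrite /c /d; lra.
by move=> ->; rewrite /= mulr_gt0//; rewrite /c /d; lra.
Qed.

End fixed_dimension.

(** [ball_integralD2] and [Gamma_halfD1] give both normalizations the same recursion of step two, so
    explicit integration is needed only in dimensions 2 and 3. *)
Lemma mu_density_ball n (t : R) : (2 <= n)%N ->
  mu_density n t = (ball_integral n 1)^-1 * (1 - t ^+ 2) `^ ((n%:R - 3) / 2).
Proof.
move=> n2; rewrite /mu_density; congr (_ * _).
have sp : Num.sqrt pi != 0 :> R by rewrite gt_eqF// sqrtr_gt0 pi_gt0.
elim/ltn_ind: n n2 => -[//|[//|[|[|n]]]] IH _.
- rewrite ball_integral2 Gamma1 (_ : 2%:R - 1 = 1%:R); last by ring.
  by rewrite Gamma_half -expr2 sqr_sqrtr ?pi_ge0// mul1r.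
- rewrite ball_integral3 (_ : 3%:R - 1 = 2%:R); last by ring.
  by rewrite Gamma1 (@Gamma_halfD1 R 1)// Gamma_half; field.
have -> : n.+4%:R - 1 = n.+3%:R :> R by rewrite -(natr1 n.+3) addrK.
rewrite (@Gamma_halfD1 R n.+2)// (@Gamma_halfD1 R n.+1)//.
have := IH n.+2 (leqW (leqnn _)) isT.
have -> : n.+2%:R - 1 = n.+1%:R :> R by rewrite -(natr1 n.+1) addrK.
have := @ball_integralD2 n.+2 isT.
have -> : n.+2%:R - 1 = n.+1%:R :> R by rewrite -(natr1 n.+1) addrK.
set G := Gamma (n.+1%:R / 2); set G' := Gamma _; set B := ball_integral n.+2 1.
set B' := ball_integral _ 1 => BE GE.
have n0 : n.+2%:R != 0 :> R by rewrite pnatr_eq0.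
have n1 : n.+1%:R != 0 :> R by rewrite pnatr_eq0.
have -> : B' = n.+1%:R / n.+2%:R * B by rewrite mulrAC -BE mulrAC divff ?mul1r.
rewrite [in RHS]invfM -GE !invfM.
move: (G^-1) (Num.sqrt pi)^-1 (n.+1%:R : R) (n.+2%:R : R) n1 n0 => g s u v u0 v0.
by field; rewrite u0 v0.
Qed.

Definition mu_int (n : nat) (p : {poly R}) : R :=
  wint (mu_density n) (fun t => p.[t]).

Section functional.
Variables (n : nat) (n2 : (2 <= n)%N).

Lemma mu_intE (p : {poly R}) :
  mu_int n p = (ball_integral n 1)^-1 * ball_integral n p.
Proof.
rewrite /mu_int /wint /ball_integral -RintegralZl//; last exact: ball_integrable.
by apply: eq_Rintegral => t _; rewrite (mu_density_ball t n2) mulrCA.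
Qed.

Lemma mu_int_is_scalar : scalar (mu_int n).
Proof.
move=> a p q; rewrite !mu_intE ball_integralD// ball_integralZ//.
by rewrite mulrDr mulrCA.
Qed.

Let ball1 : 0 < ball_integral n 1.
Proof.
by apply: ball_integral_gt0 => // [|t _]; rewrite ?oner_eq0// hornerC.
Qed.

Lemma mu_int1 : mu_int n 1 = 1.
Proof. by rewrite mu_intE mulVf// gt_eqF. Qed.

Lemma mu_int_parts (p : {poly R}) :
  mu_int n ((1 - 'X^2) * p^`()) = (n%:R - 1) * mu_int n ('X * p).
Proof. by rewrite !mu_intE ball_integral_parts// mulrCA. Qed.

Lemma mu_int_gt0 (p : {poly R}) : p != 0 ->
  (forall t, -1 < t < 1 -> 0 <= p.[t]) -> 0 < mu_int n p.
Proof.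
by move=> p0 pge0; rewrite mu_intE mulr_gt0 ?invr_gt0// ball_integral_gt0.
Qed.

End functional.
End mu_integral.

(** * Gegenbauer polynomials *)

Lemma natr_poly_neq0 (R : numDomainType) m : (m.+1%:R : {poly R}) != 0.
Proof. by rewrite -polyC_natr polyC_eq0 pnatr_eq0. Qed.

Section ultraspherical_polynomials.
Variables (R : realFieldType) (d : nat).

(* The pair [(P_i, P_(i+1))] for the dimension [d.+2]. *)
Fixpoint ultra2 (i : nat) : {poly R} * {poly R} :=
  if i is i'.+1 then
    let: (p, q) := ultra2 i' in
    (q, ((d + i)%:R)^-1 *: ((2 * i + d)%:R *: ('X * q) - i%:R *: p))
  else (1, 'X).

Definition ultra (i : nat) : {poly R} := (ultra2 i).1.

Lemma ultra0 : ultra 0 = 1. Proof. by []. Qed.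
Lemma ultra1 : ultra 1 = 'X. Proof. by []. Qed.

Lemma ultraSS_scale i : (d + i.+1)%:R *: ultra i.+2 =
  (2 * i.+1 + d)%:R *: ('X * ultra i.+1) - i.+1%:R *: ultra i.
Proof.
have -> : ultra i.+2 = ((d + i.+1)%:R)^-1 *:
    ((2 * i.+1 + d)%:R *: ('X * ultra i.+1) - i.+1%:R *: ultra i).
  by rewrite /ultra /=; case: (ultra2 i).
by rewrite scalerA mulfV ?scale1r// addnS pnatr_eq0.
Qed.

Lemma ultraSS i : (d + i.+1)%:R * ultra i.+2 =
  (2 * i.+1 + d)%:R * ('X * ultra i.+1) - i.+1%:R * ultra i.
Proof. by have := ultraSS_scale i; rewrite !scaler_nat !mulr_natl. Qed.

Lemma ultra_at1 i : (ultra i).[1] = 1.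
Proof.
suff : (ultra i).[1] = 1 /\ (ultra i.+1).[1] = 1 by case.
elim: i => [|i [IH1 IH2]]; first by rewrite ultra0 ultra1 hornerC hornerX.
split=> //; have n0 : (d + i.+1)%:R != 0 :> R by rewrite addnS pnatr_eq0.
apply: (mulfI n0); have /(congr1 (horner^~ 1)) := ultraSS i.
rewrite -!polyC_natr !(hornerD, hornerN, hornerM, hornerX, hornerC) IH1 IH2 => ->.
by rewrite !natrD natrM; ring.
Qed.

Lemma ultra_parity i : ultra i \Po (- 'X) = (-1) ^+ i * ultra i.
Proof.
suff : ultra i \Po (- 'X) = (-1) ^+ i * ultra i /\
  ultra i.+1 \Po (- 'X) = (-1) ^+ i.+1 * ultra i.+1 by case.
elim: i => [|i [IH1 IH2]].
  by rewrite ultra0 ultra1 comp_polyC comp_polyX expr0 expr1 mul1r mulN1r.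
split=> //; have n0 : ((d + i.+1)%:R : {poly R}) != 0 by rewrite addnS natr_poly_neq0.
apply: (mulfI n0); have /(congr1 (comp_poly (- 'X))) := ultraSS i.
rewrite -!polyC_natr rmorphB !rmorphM /= !comp_polyC comp_polyX IH1 IH2 => ->.
rewrite !polyC_natr [RHS]mulrCA ultraSS !exprS; ring.
Qed.

Lemma ultra_atN1 i : (ultra i).[-1] = (-1) ^+ i.
Proof.
have /(congr1 (horner^~ 1)) := ultra_parity i.
rewrite horner_comp hornerN hornerX => ->.
by rewrite hornerM ultra_at1 mulr1 -polyCN -polyC_exp hornerC.
Qed.

Lemma size_lead_ultra i : size (ultra i) = i.+1 /\ 0 < lead_coef (ultra i).
Proof.
suff : (size (ultra i) = i.+1 /\ 0 < lead_coef (ultra i)) /\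
  (size (ultra i.+1) = i.+2 /\ 0 < lead_coef (ultra i.+1)) by case.
elim: i => [|i [[s1 l1] [s2 l2]]].
  by rewrite ultra0 ultra1 size_poly1 size_polyX lead_coef1 lead_coefX.
split=> //; have n0 : 0 < (d + i.+1)%:R :> R by rewrite addnS ltr0n.
have c0 : 0 < (2 * i.+1 + d)%:R :> R by rewrite mulnS ltr0n.
have E := ultraSS_scale i.
have sX : size ((2 * i.+1 + d)%:R *: ('X * ultra i.+1)) = i.+3.
  by rewrite size_scale ?gt_eqF// mulrC size_mulX ?s2// -size_poly_gt0 s2.
have lt : (size (- (i.+1%:R *: ultra i))%R < size ((2 * i.+1 + d)%:R *: ('X * ultra i.+1))%R)%N.
  by rewrite size_polyN sX (leq_ltn_trans (size_scale_leq _ _))// s1.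
split.
  by rewrite -(size_scale _ (lt0r_neq0 n0)) E size_polyDl.
rewrite -(pmulr_rgt0 _ n0) -lead_coefZ E lead_coefDl// lead_coefZ ['X * _]mulrC lead_coefMX.
by rewrite mulr_gt0.
Qed.

Lemma size_ultra i : size (ultra i) = i.+1.
Proof. by have [] := size_lead_ultra i. Qed.

Lemma lead_ultra_gt0 i : 0 < lead_coef (ultra i).
Proof. by have [] := size_lead_ultra i. Qed.

(** The link between the recurrence and integration by parts: the left side has the shape to which
    [L_parts] applies. Two consecutive indices are carried because the recurrence reaches back
    two. *)
Lemma ultra_deriv i :
  (1 - 'X^2) * (ultra i.+1)^`() = i.+1%:R * (ultra i - 'X * ultra i.+1).
Proof.
suff : (1 - 'X^2) * (ultra i.+1)^`() = i.+1%:R * (ultra i - 'X * ultra i.+1) /\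
  (1 - 'X^2) * (ultra i.+2)^`() = i.+2%:R * (ultra i.+1 - 'X * ultra i.+2) by case.
have dr j : (d + j.+1)%:R * (ultra j.+2)^`() =
  (2 * j.+1 + d)%:R * (ultra j.+1 + 'X * (ultra j.+1)^`()) - j.+1%:R * (ultra j)^`().
  have /(congr1 (@deriv R)) := ultraSS j.
  by rewrite derivB !mulr_natl !derivMn derivM derivX mul1r.
have n0 j : ((d + j.+1)%:R : {poly R}) != 0 by rewrite addnS natr_poly_neq0.
elim: i => [|i [IH1 IH2]]; split.
- by rewrite ultra0 ultra1 derivX; ring.
- apply: (mulfI (n0 0%N)); rewrite mulrCA dr ultra0 ultra1 derivX derivC mulr0 subr0.
  have := ultraSS 0; rewrite ultra0 ultra1 => E.
  rewrite [RHS](_ : _ = 2%:R * ((d + 1)%:R * 'X - 'X * ((d + 1)%:R * ultra 2))); last by ring.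
  by rewrite E; ring.
- exact: IH2.
apply: (mulfI (n0 i.+1)).
rewrite mulrCA dr.
rewrite [LHS](_ : _ = (2 * i.+2 + d)%:R * ((1 - 'X^2) * ultra i.+2 +
    'X * ((1 - 'X^2) * (ultra i.+2)^`())) - i.+2%:R * ((1 - 'X^2) * (ultra i.+1)^`())); last by ring.
rewrite IH1 IH2.
rewrite [RHS](_ : _ = i.+3%:R * ((d + i.+2)%:R * ultra i.+2 - 'X * ((d + i.+2)%:R * ultra i.+3))); last by ring.
rewrite (ultraSS i.+1).
have := ultraSS i => E.
(* The recurrence is read backwards to eliminate [ultra i], leaving only indices [i.+1] and [i.+2]
   on both sides. *)
have {}E : i.+1%:R * ultra i = (2 * i.+1 + d)%:R * ('X * ultra i.+1) - (d + i.+1)%:R * ultra i.+2.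
  by rewrite E; ring.
rewrite [X in _ - X](_ : _ = i.+2%:R * (i.+1%:R * ultra i - i.+1%:R * 'X * ultra i.+1)); last by ring.
by rewrite E; ring.
Qed.

End ultraspherical_polynomials.

(** * Orthogonality, norms and kernels for an abstract positive functional *)

Section ultraspherical_functional.
Variables (R : realFieldType) (d : nat) (L : {poly R} -> R).
Hypothesis L_scalar : scalar L.
Hypothesis L1 : L 1 = 1.
Hypothesis L_parts :
  forall p, L ((1 - 'X^2) * p^`()) = d.+1%:R * L ('X * p).
Hypothesis L_gt0 : forall p : {poly R}, p != 0 ->
  (forall t, -1 < t < 1 -> 0 <= p.[t]) -> 0 < L p.
Local Notation G := (@ultra R d).

Lemma L_D p q : L (p + q) = L p + L q.
Proof. by have := L_scalar 1 p q; rewrite scale1r mul1r. Qed.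

Lemma L_0 : L 0 = 0.
Proof. by apply: (addrI (L 0)); rewrite -L_D !addr0. Qed.

Lemma L_Z c p : L (c *: p) = c * L p.
Proof. by rewrite -[c *: p]addr0 L_scalar L_0 addr0. Qed.

Lemma L_B p q : L (p - q) = L p - L q.
Proof. by rewrite L_D -scaleN1r L_Z mulN1r. Qed.

Lemma L_sum (I : finType) (F : I -> {poly R}) : L (\sum_i F i) = \sum_i L (F i).
Proof. exact: (big_morph L L_D L_0). Qed.

Lemma L_Mn m p : L (m%:R * p) = m%:R * L p.
Proof. by rewrite -polyC_natr mul_polyC L_Z. Qed.

Lemma L_C c p : L (c%:P * p) = c * L p.
Proof. by rewrite mul_polyC L_Z. Qed.

Lemma L_sqr_eq0 p : L (p * p) = 0 -> p = 0.
Proof.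
move=> Lp0; apply/eqP/negPn/negP => p0.
have : 0 < L (p * p).
  by apply: L_gt0 => [|t _]; rewrite ?mulf_neq0// hornerM -expr2 sqr_ge0.
by rewrite Lp0 ltxx.
Qed.

(** Integration by parts, the derivative formula and the recurrence combine to [(d+j+2)(d+j+1)
    L(G_(j+2)) = (j+1) j L(G_j)]. The odd chain starts from [L X = 0]; in the even chain the factor
    [j] vanishes at [j = 0]. *)
Lemma L_ultraS i : L (G i.+1) = 0.
Proof.
have n0 j : (j.+1%:R : R) != 0 by rewrite pnatr_eq0.
suff : L (G i.+1) = 0 /\ L (G i.+2) = 0 by case.
have LX j : (d + j.+2)%:R * L ('X * G j.+1) = j.+1%:R * L (G j).
  have := L_parts (G j.+1); rewrite ultra_deriv L_Mn L_B => E.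
  have -> : (d + j.+2)%:R = d.+1%:R + j.+1%:R :> R by rewrite -natrD addSnnS.
  by rewrite mulrDl -E; ring.
have step j : (d + j.+2)%:R * ((d + j.+1)%:R * L (G j.+2)) = j.+1%:R * j%:R * L (G j).
  rewrite -L_Mn ultraSS L_B !L_Mn mulrBr mulrCA LX.
  rewrite !natrD natrM -(natr1 j.+1) -(natr1 j); ring.
have Lx : L (G 1) = 0.
  by apply: (mulfI (n0 d)); rewrite mulr0 ultra1 -['X]mulr1 -L_parts derivC mulr0 L_0.
elim: i => [|i [IH1 IH2]]; split=> //.
  have /eqP := step 0%N; rewrite mulr0 mul0r addnS addn1 !mulf_eq0 !pnatr_eq0/=.
  by move=> /eqP.
have /eqP := step i.+1; rewrite IH1 mulr0 !addnS !mulf_eq0 !pnatr_eq0/=.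
by move=> /eqP.
Qed.

(** The recurrence trades one power of ['X] for a shift of the index by one, which keeps the index
    above the remaining exponent. *)
Lemma L_ultraXn i j : (j < i)%N -> L (G i * 'X^j) = 0.
Proof.
elim: j i => [|j IH] [//|i] ji; first by rewrite expr0 mulr1 L_ultraS.
have n0 : (2 * i.+1 + d)%:R != 0 :> R by rewrite mulnS pnatr_eq0.
apply: (mulfI n0); rewrite mulr0 -L_Mn exprS.
rewrite (_ : _ * _ = (2 * i.+1 + d)%:R * ('X * G i.+1) * 'X^j); last by ring.
have -> : (2 * i.+1 + d)%:R * ('X * G i.+1) = (d + i.+1)%:R * G i.+2 + i.+1%:R * G i.
  by rewrite ultraSS; ring.
rewrite mulrDl -!mulrA L_D !L_Mn !IH ?mulr0 ?addr0//.
exact: leq_trans (ltnW ji) (leqnSn _).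
Qed.

Lemma L_ultra_orth i (q : {poly R}) : (size q <= i)%N -> L (G i * q) = 0.
Proof.
move=> qi; rewrite -[q]coefK poly_def mulr_sumr L_sum big1// => j _.
rewrite -scalerAr L_Z L_ultraXn ?mulr0//.
by rewrite (leq_trans (ltn_ord j)).
Qed.

Lemma ultra_expand m (f : {poly R}) : (size f <= m)%N ->
  exists2 c : nat -> R, f = \sum_(i < m) c i *: G i &
    forall i, (m <= i)%N -> c i = 0.
Proof.
elim: m f => [|m IH] f.
  by rewrite size_poly_leq0 => /eqP ->; exists (fun=> 0) => //; rewrite big_ord0.
move=> fm; pose a := f`_m / lead_coef (G m).
have : (size (f - a *: G m)%R <= m)%N.
  apply/leq_sizeP => j; rewrite leq_eqVlt => /predU1P[<-|mj].
    rewrite coefB coefZ /a -[(G m)`_m](_ : lead_coef (G m) = _); last by rewrite lead_coefE size_ultra.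
    by rewrite divfK ?subrr// gt_eqF// lead_ultra_gt0.
  rewrite coefB coefZ [f`_j]nth_default ?(leq_trans fm)// nth_default ?mulr0 ?subrr//.
  by rewrite size_ultra.
case/IH => c fE c0; exists (fun i => if i == m then a else c i).
  rewrite big_ord_recr /= eqxx -[f in LHS](subrK (a *: G m)) fE; congr (_ + _).
  by apply: eq_bigr => i _; rewrite ltn_eqF.
by move=> i mi; rewrite gtn_eqF// c0// ltnW.
Qed.

Lemma orthogonal_ultra i (p : {poly R}) : size p = i.+1 -> p.[1] = 1 ->
  (forall q : {poly R}, (size q <= i)%N -> L (p * q) = 0) -> p = G i.
Proof.
move=> sp p1 po; pose a := lead_coef p / lead_coef (G i).
have : (size (p - a *: G i)%R <= i)%N.
  apply/leq_sizeP => j; rewrite leq_eqVlt => /predU1P[<-|mj].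
    rewrite coefB coefZ /a -[(G i)`_i](_ : lead_coef (G i) = _); last by rewrite lead_coefE size_ultra.
    rewrite divfK ?gt_eqF ?lead_ultra_gt0//.
    by rewrite lead_coefE sp subrr.
  by rewrite coefB coefZ ![_`_j]nth_default ?mulr0 ?subrr ?size_ultra ?sp.
move=> sq; have : L ((p - a *: G i) * (p - a *: G i)) = 0.
  by rewrite [X in L X]mulrBl L_B -scalerAl L_Z po// L_ultra_orth// mulr0 subrr.
move=> /L_sqr_eq0/eqP; rewrite subr_eq0 => /eqP pE.
by move: p1; rewrite {1}pE hornerZ ultra_at1 mulr1 => a1; rewrite pE a1 scale1r.
Qed.

(** Reflection only changes the signs of some [G i] with [i > 0], and [L] kills all of these. *)
Lemma L_comp_oppX p : L (p \Po (- 'X)) = L p.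
Proof.
have [c -> _] := ultra_expand (leqnn (size p)).
rewrite raddf_sum !L_sum; apply: eq_bigr => i _ /=.
rewrite linearZ/= ultra_parity !L_Z.
case: {c}(nat_of_ord i) (c i) => [|j] c; first by rewrite expr0 mul1r.
by rewrite -polyCN -polyC_exp L_C L_ultraS !mulr0.
Qed.

(* [ultra_dim j] is the dimension of the space of spherical harmonics of
   degree j in dimension [d.+2]; it is the inverse of [L (G j * G j)]. *)
Definition ultra_dim (i : nat) : R :=
  'C(d + i, d)%:R + (if i is i'.+1 then 'C(d + i', d)%:R else 0).

Local Notation c i := ('C(d + i, d)%:R : R).
Local Notation r := ultra_dim.

Lemma bin_diagS i : i.+1%:R * c i.+1 = (d + i.+1)%:R * c i.
Proof.
rewrite -!natrM; congr (_ %:R); have := mul_bin_down (d + i).+1 d.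
by rewrite addnS /= subSn ?leq_addr// addKn => ->.
Qed.

Lemma ultra_dim_gt0 i : 0 < r i.
Proof.
rewrite /r ltr_wpDr ?ltr0n ?bin_gt0 ?leq_addr//.
by case: i => // i; rewrite ler0n.
Qed.

Lemma ultra_dimS i : i.+1%:R * r i.+1 = (2 * i.+1 + d)%:R * c i.
Proof.
rewrite /r mulrDr bin_diagS -mulrDl -natrD; congr (_%:R * _).
by rewrite mul2n -addnn addnAC addnC addnA.
Qed.

Lemma L_ultraM i j : i != j -> L (G i * G j) = 0.
Proof.
wlog ij : i j / (i < j)%N => [H|_].
  by rewrite neq_ltn => /orP[ij|ij]; [|rewrite mulrC]; apply: H; rewrite // ?ltn_eqF.
by rewrite mulrC L_ultra_orth// size_ultra.
Qed.

(** Multiplying the recurrence by [G j] and by [G j.+2] evaluates the mixed moments [M] in two ways,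
    which gives the ratio of consecutive norms; [ultra_dimS] and [bin_diagS] show that [r] has the
    inverse ratio. *)
Lemma L_ultra_sqr i : r i * L (G i * G i) = 1.
Proof.
pose M i := L ('X * G i.+1 * G i).
have n0 j : (j.+1%:R : R) != 0 by rewrite pnatr_eq0.
have eM j : (2 * j.+1 + d)%:R * M j = j.+1%:R * L (G j * G j).
  have /(congr1 (fun p => L (p * G j))) := ultraSS R d j.
  rewrite mulrBl -!mulrA L_B !L_Mn L_ultraM ?mulr0; last by rewrite gtn_eqF// ltnW.
  by move=> /esym/eqP; rewrite subr_eq0 /M -mulrA => /eqP.
have eN j : (d + j.+1)%:R * L (G j.+2 * G j.+2) = (2 * j.+1 + d)%:R * M j.+1.
  have /(congr1 (fun p => L (p * G j.+2))) := ultraSS R d j.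
  rewrite mulrBl -!mulrA L_B !L_Mn [L (G j * _)]L_ultraM ?mulr0 ?subr0; last by rewrite ltn_eqF// ltnW.
  by move=> ->; rewrite /M -mulrA; congr (_ * L _); ring.
elim: i => [|[|i] IH].
- by rewrite /r addn0 binn ultra0 addr0 !mul1r.
- have := eM 0%N; rewrite /M ultra0 !mulr1 ultra1 L1 mulr1.
  have := ultra_dimS 0; rewrite !mul1r addn0 binn mulr1 => ->.
  by [].
have cn0 : (d + i.+1)%:R != 0 :> R by rewrite addnS pnatr_eq0.
apply: (mulfI (n0 i)); apply: (mulfI cn0); apply: (mulfI (n0 i.+1)).
rewrite [LHS](_ : _ = i.+1%:R * (i.+2%:R * r i.+2) *
  ((d + i.+1)%:R * L (G i.+2 * G i.+2))); last by ring.
rewrite ultra_dimS eN.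
rewrite [LHS](_ : _ = (i.+1%:R * c i.+1) * (2 * i.+1 + d)%:R *
  ((2 * i.+2 + d)%:R * M i.+1)); last by ring.
rewrite bin_diagS eM.
rewrite [LHS](_ : _ = (d + i.+1)%:R * i.+2%:R * L (G i.+1 * G i.+1) *
  ((2 * i.+1 + d)%:R * c i)); last by ring.
rewrite -ultra_dimS.
rewrite [LHS](_ : _ = (d + i.+1)%:R * i.+2%:R * i.+1%:R *
  (r i.+1 * L (G i.+1 * G i.+1))); last by ring.
by rewrite IH; ring.
Qed.

Definition ultra_kernel (i : nat) : {poly R} := \sum_(j < i.+1) r j *: G j.
Local Notation q := ultra_kernel.

Lemma ultra_kernelS i : q i.+1 = q i + r i.+1 *: G i.+1.
Proof. by rewrite /q big_ord_recr. Qed.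

Lemma ultra_kernelE i : (1 - 'X) * q i = c i *: (G i - G i.+1).
Proof.
elim: i => [|i IH].
  by rewrite /q big_ord1 /r addn0 binn addr0 !scale1r ultra0 ultra1 mulr1.
have n0 : (i.+1%:R : {poly R}) != 0 by exact: natr_poly_neq0.
rewrite ultra_kernelS mulrDr IH -!mul_polyC; apply: (mulfI n0).
have C1 : i.+1%:R * (c i.+1)%:P = (d + i.+1)%:R * (c i)%:P :> {poly R}.
  by rewrite -!polyC_natr -!polyCM bin_diagS.
have C2 : i.+1%:R * (r i.+1)%:P = (2 * i.+1 + d)%:R * (c i)%:P :> {poly R}.
  by rewrite -!polyC_natr -!polyCM ultra_dimS.
rewrite [LHS](_ : _ = i.+1%:R * (c i)%:P * (G i - G i.+1) +
  (i.+1%:R * (r i.+1)%:P) * ((1 - 'X) * G i.+1)); last by ring.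
rewrite C2.
rewrite [RHS](_ : _ = (i.+1%:R * (c i.+1)%:P) * (G i.+1 - G i.+2)); last by ring.
rewrite C1.
rewrite [RHS](_ : _ = (c i)%:P * ((d + i.+1)%:R * G i.+1 - (d + i.+1)%:R * G i.+2)); last by ring.
by rewrite ultraSS !natrD natrM; ring.
Qed.

Lemma L_ultra_kernel i (f : {poly R}) : (size f <= i.+1)%N -> L (q i * f) = f.[1].
Proof.
move=> /ultra_expand[a -> _].
rewrite mulr_sumr L_sum horner_sum; apply: eq_bigr => j _.
rewrite -scalerAr L_Z hornerZ ultra_at1; congr (_ * _).
rewrite /q mulr_suml L_sum (bigD1 j)//= big1 ?addr0; last first.
  by move=> l lj; rewrite -scalerAl L_Z L_ultraM ?mulr0.
by rewrite -scalerAl L_Z L_ultra_sqr.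
Qed.

(** By Pascal's rule. In dimension [n = d + 2] this value is D(n, 2i), which is how the Delsarte
    bound meets the kernels. *)
Lemma ultra_kernel_at1 i :
  (q i).[1] = 'C(d.+1 + i, d.+1)%:R + (if i is i'.+1 then 'C(d.+1 + i', d.+1)%:R else 0).
Proof.
elim: i => [|i IH].
  by rewrite /q big_ord1 /r hornerZ ultra0 hornerC !addn0 !binn mulr1.
rewrite ultra_kernelS hornerD hornerZ ultra_at1 mulr1 IH /r.
have e j : 'C(d.+1 + j.+1, d.+1)%:R = 'C(d.+1 + j, d.+1)%:R + c j.+1 :> R.
  by rewrite -natrD addnS binS addSnnS.
case: i {IH} => [|i]; rewrite !e; last by ring.
by rewrite !addn0 !binn; ring.
Qed.

Lemma ultra_kernel_atN1 i : (q i).[-1] = (-1) ^+ i * c i.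
Proof.
have /(congr1 (horner^~ (-1))) := ultra_kernelE i.
rewrite hornerM hornerZ !(hornerD, hornerN) hornerC hornerX !ultra_atN1 exprS => E.
have n2 : 2 != 0 :> R by rewrite pnatr_eq0.
apply: (mulfI n2); rewrite (_ : 2 = 1 - -1) ?E; last by ring.
by move: ((-1) ^+ i) => z; ring.
Qed.

Lemma size_ultra_kernel i : size (q i) = i.+1.
Proof.
case: i => [|i]; first by rewrite /q big_ord1 size_scale ?size_ultra// gt_eqF// ultra_dim_gt0.
rewrite ultra_kernelS addrC size_polyDl size_scale ?size_ultra ?gt_eqF ?ultra_dim_gt0//.
rewrite ltnS (leq_trans (size_sum _ _ _))//; apply/bigmax_leqP => j _.
by rewrite (leq_trans (size_scale_leq _ _))// size_ultra.
Qed.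

Lemma coef_ultra_kernel i : (q i)`_i = r i * lead_coef (G i).
Proof.
rewrite /q coef_sum big_ord_recr /= big1 ?add0r; last first.
  by move=> j _; rewrite coefZ nth_default ?mulr0// size_ultra.
by rewrite coefZ lead_coefE size_ultra.
Qed.

(** The shape in which the value at 1 occurs in the Levenshtein function: the binomial times the
    first term in its bracket. *)
Lemma ultra_kernel_at1_bin k : d.+1%:R * (q k).[1] = (2 * k + d.+1)%:R * c k.
Proof.
have e j : d.+1%:R * 'C(d.+1 + j, d.+1)%:R = (d + j.+1)%:R * c j.
  by rewrite -!natrM addSn -mul_bin_diag /= addnS.
rewrite ultra_kernel_at1 mulrDr e; case: k => [|k].
  by rewrite mulr0 addr0 muln0 add0n addn1.
rewrite e -(bin_diagS k) -mulrDl -natrD; congr (_%:R * _).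
by rewrite mul2n -addnn; lia.
Qed.

Lemma L_orthogonal_eq0 m (S : {poly R}) : (size S <= m)%N ->
  (forall f : {poly R}, (size f <= m)%N -> L (S * f) = 0) -> S = 0.
Proof. by move=> sS So; apply: L_sqr_eq0; apply: So. Qed.

Lemma divp_at1 (f : {poly R}) : exists2 g : {poly R},
  f = f.[1]%:P + (1 - 'X) * g & (size g <= (size f).-1)%N.
Proof.
exists (- (f %/ ('X - 1%:P))).
  rewrite -modp_XsubC {1}(divp_eq f ('X - 1%:P)) addrC; congr (_ + _).
  by rewrite polyC1; ring.
by rewrite size_polyN size_divp ?polyXsubC_eq0// size_XsubC subn1.
Qed.

(** The case e = 0, with [k] here one less than in the theorem. Every test polynomial is a constant
    plus a multiple of [1 - 'X], so [T] minus a multiple of the kernel at 1 is orthogonal to all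
    degrees at most [k], hence a multiple of [G k.+1]. *)
Lemma node_poly_odd k (T : {poly R}) s M :
  T \is monic -> size T = k.+2 -> T.[s] = 0 ->
  (forall g : {poly R}, (size g <= k)%N -> L ((1 - 'X) * T * g) = 0) ->
  2 * 'C(d.+1 + k, d.+1)%:R < M ->
  c k * ((2 * k + d.+1)%:R / d.+1%:R -
    ((G k).[s] - (G k.+1).[s]) / ((1 - s) * (G k.+1).[s])) = M ->
  [/\ T.[1] = M * L T, 0 < T.[1] & 0 < (-1) ^+ k.+1 * T.[-1]].
Proof.
move=> Tm sT Ts To bM ME.
have d0 : d.+1%:R != 0 :> R by rewrite pnatr_eq0.
have lG := lead_ultra_gt0 R d k.+1.
(* [a] is forced by pairing with 1, since [L (q k.+1) = 1]; [b] cancels the top coefficient, after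
   which the remainder is orthogonal to itself. *)
pose a := L T; pose S : {poly R} := T - a *: q k.+1; pose b := S`_k.+1 / lead_coef (G k.+1).
have So (f : {poly R}) : (size f <= k.+1)%N -> L (S * f) = 0.
  move=> sf; have [g fE sg] := divp_at1 f; move: f.[1] fE => f1 fE.
  have {}sg : (size g <= k)%N.
    by apply: leq_trans sg _; rewrite -subn1 leq_subLR add1n.
  have sXg : (size ((1 - 'X) * g)%R <= k.+2)%N.
    rewrite (leq_trans (size_polyMleq _ _))// -subn1 leq_subLR.
    rewrite (_ : (1 + k.+2 = 2 + k.+1)%N)// leq_add//; last by rewrite leqW.
    by rewrite -opprB size_polyN -polyC1 size_XsubC.
  rewrite fE mulrDr L_D [S * _%:P]mulrC L_C {1}/S L_B L_Z.
  have -> : L (q k.+1) = 1 by rewrite -[q _]mulr1 L_ultra_kernel ?hornerC// size_poly1.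
  rewrite mulr1 subrr mulr0 add0r /S mulrBl L_B -scalerAl L_Z L_ultra_kernel//.
  rewrite mulrA [T * _]mulrC To// hornerM hornerD hornerN hornerX hornerC subrr mul0r.
  by rewrite mulr0 subr0.
have TE : T = a *: q k.+1 + b *: G k.+1.
  apply/eqP; rewrite -subr_eq0 opprD addrA -/S; apply/eqP.
  apply: (@L_orthogonal_eq0 k.+1).
    apply/leq_sizeP => j; rewrite leq_eqVlt => /predU1P[<-|kj].
      rewrite coefB coefZ /b -[(G k.+1)`_k.+1](_ : lead_coef (G k.+1) = _).
        by rewrite divfK ?subrr// gt_eqF.
      by rewrite lead_coefE size_ultra.
    rewrite coefB !coefZ coefB coefZ ![_`_j]nth_default ?mulr0 ?subrr//.
    - by rewrite size_ultra.
    - by rewrite size_ultra_kernel.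
    - by rewrite sT.
  by move=> f sf; rewrite mulrBl L_B So// -scalerAl L_Z L_ultra_orth// mulr0 subrr.
(* [T] is monic. The sign of [a] alone becomes available only once [b] is known in terms of [a]. *)
have lead : 0 < a * r k.+1 + b.
  rewrite -(pmulr_lgt0 _ lG); have : T`_k.+1 = 1.
    by move/monicP: Tm; rewrite lead_coefE sT.
  rewrite TE coefD !coefZ coef_ultra_kernel -[(G k.+1)`_k.+1](_ : lead_coef (G k.+1) = _).
    by move=> E; rewrite mulrDl -mulrA E ltr01.
  by rewrite lead_coefE size_ultra.
have RE : c k * ((2 * k + d.+1)%:R / d.+1%:R) = (q k).[1].
  apply: (mulfI d0); rewrite ultra_kernel_at1_bin mulrCA.
  by rewrite [d.+1%:R * _]mulrC divfK// mulrC.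
have Rb : (q k).[1] <= 2 * 'C(d.+1 + k, d.+1)%:R.
  rewrite ultra_kernel_at1 mulr2n mulrDl mul1r lerD2l.
  case: k {bM ME RE lead TE So b S To sT lG Ts} => [|k]; first by rewrite ler0n.
  by rewrite ler_nat leq_bin2l// addnS.
have M1 : (q k).[1] < M by exact: le_lt_trans bM.
move: ME; rewrite mulrBr RE => ME.
have qs : c k * ((G k).[s] - (G k.+1).[s]) = (1 - s) * (q k).[s].
  have /(congr1 (horner^~ s)) := ultra_kernelE k.
  by rewrite hornerM hornerZ !(hornerD, hornerN) hornerC hornerX => ->.
(* If a denominator vanished, the fraction would be 0 by convention and [M] would equal [(q k).[1]],
   which is below the Delsarte bound. *)
have [s1|s1] := eqVneq (1 - s) 0.
  by move: ME; rewrite s1 mul0r invr0 !mulr0 subr0 => ME; rewrite ME ltxx in M1.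
have [G0|G0] := eqVneq (G k.+1).[s] 0.
  by move: ME; rewrite G0 mulr0 invr0 !mulr0 subr0 => ME; rewrite ME ltxx in M1.
have {}ME : (q k.+1).[1] - (q k.+1).[s] / (G k.+1).[s] = M.
  rewrite -ME mulrA qs !ultra_kernelS !(hornerD, hornerZ) ultra_at1.
  by field; rewrite s1 G0.
have bE : b = a * (M - (q k.+1).[1]).
  move: Ts; rewrite TE hornerD !hornerZ -ME => Ts.
  apply: (mulIf G0); rewrite -[LHS](addKr (a * (q k.+1).[s])) Ts addr0.
  by field.
have a0 : 0 < a.
  move: lead; rewrite bE ultra_kernelS hornerD hornerZ ultra_at1.
  rewrite (_ : _ + _ = a * (M - (q k).[1])); last by ring.
  by rewrite pmulr_lgt0// subr_gt0.
have T1 : T.[1] = M * a by rewrite TE hornerD !hornerZ ultra_at1 bE; ring.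
split=> //.
  by rewrite T1 mulr_gt0// (le_lt_trans _ bM)// mulr_ge0.
rewrite TE hornerD !hornerZ ultra_atN1 ultra_kernel_atN1.
(* Since [(q k.+1).[1] - c k.+1] is the Delsarte bound, the quantity is [a] times the gap in
   [bM]. *)
rewrite [X in 0 < X](_ : _ = ((-1) ^+ k.+1) ^+ 2 * (a * c k.+1 + b)); last by ring.
rewrite sqrr_sign mul1r bE -mulrDr mulr_gt0// ultra_kernel_at1.
have := bM; rewrite (_ : 'C(d.+1 + k.+1, d.+1)%:R = 'C(d.+1 + k, d.+1)%:R + c k.+1); first by lra.
by rewrite -natrD addnS binS addSnnS.
Qed.

(** The Christoffel-Darboux kernel at the point -1; the sign gives it the same positive leading
    coefficient as the kernel at 1. *)
Definition ultra_kernelN (i : nat) : {poly R} := (-1) ^+ i *: (q i \Po (- 'X)).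
Local Notation qN := ultra_kernelN.

Lemma horner_ultra_kernelN i t : (qN i).[t] = (-1) ^+ i * (q i).[- t].
Proof. by rewrite hornerZ horner_comp hornerN hornerX. Qed.

Lemma L_ultra_kernelN i (f : {poly R}) : (size f <= i.+1)%N ->
  L (qN i * f) = (-1) ^+ i * f.[-1].
Proof.
move=> sf; rewrite -scalerAl L_Z; congr (_ * _).
have sfX : (size (f \Po (- 'X))%R <= i.+1)%N.
  by rewrite size_comp_poly2// size_polyN size_polyX.
rewrite -L_comp_oppX rmorphM /= -comp_polyA rmorphN /= comp_polyX opprK comp_polyXr.
by rewrite L_ultra_kernel// horner_comp hornerN hornerX.
Qed.

Lemma ultra_kernelN_E i : (1 + 'X) * qN i = c i *: (G i + G i.+1).
Proof.
have /(congr1 (fun p => (-1) ^+ i *: (p \Po (- 'X)))) := ultra_kernelE i.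
rewrite rmorphM rmorphB /= comp_polyC comp_polyX opprK scalerAr => ->.
rewrite linearZ rmorphB /= !ultra_parity -!mul_polyC polyC_exp polyCN.
rewrite [LHS](_ : _ = ((-1) ^+ i) ^+ 2 * ((c i)%:P * (G i + G i.+1))); last by rewrite exprS; ring.
by rewrite sqrr_sign mul1r.
Qed.

Lemma coef_ultra_kernelN i : (qN i)`_i = r i * lead_coef (G i).
Proof.
have sq : size (q i \Po (- 'X)) = i.+1 by rewrite size_comp_poly2 ?size_polyN ?size_polyX// size_ultra_kernel.
rewrite coefZ -[(q i \Po _)`_i](_ : lead_coef (q i \Po (- 'X)) = _); last by rewrite lead_coefE sq.
rewrite lead_coef_comp ?size_polyN ?size_polyX// lead_coefN lead_coefX size_ultra_kernel /=.
by rewrite mulrCA -expr2 sqrr_sign mulr1 lead_coefE size_ultra_kernel /= coef_ultra_kernel.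
Qed.

Lemma size_ultra_kernelN i : (size (qN i) <= i.+1)%N.
Proof.
rewrite (leq_trans (size_scale_leq _ _))// size_comp_poly2 ?size_polyN ?size_polyX//.
by rewrite size_ultra_kernel.
Qed.

Lemma divp_atN1_at1 (f : {poly R}) : exists2 g : {poly R},
  f = (f.[1] / 2) *: (1 + 'X) + (f.[-1] / 2) *: (1 - 'X) + (1 - 'X^2) * g &
  (size g <= (size f).-2)%N.
Proof.
have s2 : size ('X^2 - 1 : {poly R}) = 3 by rewrite size_XnsubC.
have n2 : 2 != 0 :> R by rewrite pnatr_eq0.
exists (- (f %/ ('X^2 - 1))); last first.
  by rewrite size_polyN size_divp ?s2 -?size_poly_gt0 ?s2// subn2.
have fE := divp_eq f ('X^2 - 1); set m := f %% _ in fE.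
have sm : (size m <= 2)%N.
  by have := ltn_modp f ('X^2 - 1); rewrite -size_poly_gt0 s2.
have mE : m = (m`_0)%:P + (m`_1)%:P * 'X.
  apply/polyP => i; rewrite coefD coefC coefCM coefX.
  case: i => [|[|i]] /=; rewrite ?mulr0 ?mulr1 ?addr0 ?add0r//.
  by rewrite nth_default// (leq_trans sm).
have f1 : f.[1] = m`_0 + m`_1.
  rewrite fE [in LHS]mE !(hornerXn, hornerD, hornerM, hornerN, hornerC, hornerX).
  by ring.
have fN1 : f.[-1] = m`_0 - m`_1.
  rewrite fE [in LHS]mE !(hornerXn, hornerD, hornerM, hornerN, hornerC, hornerX).
  by ring.
rewrite {1}fE {1}mE f1 fN1 addrC mulrN; congr (_ + _); last by ring.
rewrite -!mul_polyC !polyCM !polyCB !polyCD.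
have h2 : (2^-1)%:P * 2 = 1 :> {poly R} by rewrite -(polyC_natr R 2) -polyCM mulVf.
rewrite [RHS](_ : _ = ((2^-1)%:P * 2) * ((m`_0)%:P + (m`_1)%:P * 'X)); last by ring.
by rewrite h2 mul1r.
Qed.

(** The case e = 1. Test polynomials are now reduced modulo [1 - 'X^2] to combinations of [1 + 'X]
    and [1 - 'X], so [T] is a combination of the kernels at 1 and -1. Both coefficients turn out
    positive, which yields all the signs; the last one serves the weight at the node -1. *)
Lemma node_poly_even k (T : {poly R}) s M :
  T \is monic -> size T = k.+2 -> T.[s] = 0 ->
  (forall g : {poly R}, (size g <= k)%N -> L ((1 - 'X^2) * T * g) = 0) ->
  'C(d.+1 + k.+1, d.+1)%:R + 'C(d.+1 + k, d.+1)%:R < M ->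
  c k.+1 * ((2 * k.+1 + d.+1)%:R / d.+1%:R -
    (1 + s) * ((G k.+1).[s] - (G k.+2).[s]) /
      ((1 - s) * ((G k.+1).[s] + (G k.+2).[s]))) = M ->
  [/\ 2 * T.[1] = M * L ((1 + 'X) * T), 0 < T.[1],
      0 < (-1) ^+ k.+1 * T.[-1] & 0 < (-1) ^+ k.+1 * L ((1 - 'X) * T)].
Proof.
move=> Tm sT Ts To bM ME.
have d0 : d.+1%:R != 0 :> R by rewrite pnatr_eq0.
have n2 : 2 != 0 :> R by rewrite pnatr_eq0.
have lG := lead_ultra_gt0 R d k.+1.
have sg2 : (-1) ^+ k.+1 * (-1) ^+ k.+1 = 1 :> R by rewrite -expr2 sqrr_sign.
have c0 : 0 < c k.+1 by rewrite ltr0n bin_gt0 leq_addr.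
pose A := L ((1 + 'X) * T) / 2; pose B := (-1) ^+ k.+1 * L ((1 - 'X) * T) / 2.
(* [A] and [B] are forced by pairing with [1 + 'X] and [1 - 'X], each of which vanishes at one of
   the two points. *)
have TE : T = A *: q k.+1 + B *: qN k.+1.
  apply/eqP; rewrite -subr_eq0; apply/eqP; set S : {poly R} := T - _.
  have sX (b : R) : (size (1 + b *: 'X)%R <= k.+2)%N.
    rewrite (leq_trans (size_polyD _ _))// geq_max size_poly1/=.
    by rewrite (leq_trans (size_scale_leq _ _))// size_polyX.
  have S1 (f : {poly R}) : (size f <= k.+2)%N ->
      L (S * f) = L (f * T) - A * f.[1] - B * ((-1) ^+ k.+1 * f.[-1]).
    move=> sf; rewrite /S mulrBl mulrDl L_B L_D -[(A *: _) * _]scalerAl -[(B *: _) * _]scalerAl !L_Z.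
    by rewrite L_ultra_kernel// L_ultra_kernelN// [T * f]mulrC; ring.
  apply: (@L_orthogonal_eq0 k.+2).
    rewrite /S (leq_trans (size_polyD _ _))// geq_max sT leqnn size_polyN/=.
    rewrite (leq_trans (size_polyD _ _))// geq_max; apply/andP; split.
      by rewrite (leq_trans (size_scale_leq _ _))// size_ultra_kernel.
    by rewrite (leq_trans (size_scale_leq _ _))// size_ultra_kernelN.
  move=> f sf; have [g fE sg] := divp_atN1_at1 f.
  have {}sg : (size g <= k)%N by rewrite (leq_trans sg)// -subn2 leq_subLR.
  move: (f.[1] / 2) (f.[-1] / 2) fE => u v ->.
  rewrite !mulrDr !L_D -!scalerAr !L_Z.
  have -> : L (S * (1 + 'X)) = 0.
    have := S1 (1 + 'X); rewrite -{1}['X]scale1r => /(_ (sX 1)) ->.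
    by rewrite !(hornerD, hornerX, hornerC) /A; field.
  have -> : L (S * (1 - 'X)) = 0.
    have := S1 (1 - 'X); rewrite -{1}['X]scale1r -scaleNr => /(_ (sX _)) ->.
    rewrite !(hornerD, hornerN, hornerX, hornerC) /B.
    rewrite [X in _ - X](_ : _ = ((-1) ^+ k.+1 * (-1) ^+ k.+1) * L ((1 - 'X) * T)).
      by rewrite sg2; ring.
    by move: ((-1) ^+ _) => z; field.
  rewrite !mulr0 !add0r S1.
    rewrite [(_ * g) * T]mulrAC To// !(hornerXn, hornerM, hornerD, hornerN, hornerC).
    by ring.
  rewrite (leq_trans (size_polyMleq _ _))// -subn1 leq_subLR.
  rewrite (_ : (1 + k.+2 = 3 + k)%N)// leq_add// -opprB size_polyN size_XnsubC//.
have lead : 0 < A + B.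
  rewrite -(pmulr_lgt0 _ (mulr_gt0 (ultra_dim_gt0 k.+1) lG)).
  have : T`_k.+1 = 1 by move/monicP: Tm; rewrite lead_coefE sT.
  rewrite TE coefD (coefZ A) (coefZ B) coef_ultra_kernel coef_ultra_kernelN.
  by rewrite -mulrDl => ->; rewrite ltr01.
have R1 : (q k.+1).[1] = 'C(d.+1 + k.+1, d.+1)%:R + 'C(d.+1 + k, d.+1)%:R.
  by rewrite ultra_kernel_at1.
have RE : c k.+1 * ((2 * k.+1 + d.+1)%:R / d.+1%:R) = (q k.+1).[1].
  apply: (mulfI d0); rewrite ultra_kernel_at1_bin mulrCA.
  by rewrite [d.+1%:R * _]mulrC divfK// mulrC.
rewrite -R1 in bM; move: ME; rewrite mulrBr RE => ME.
(* Otherwise [M = (q k.+1).[1]], the Delsarte bound itself. As division by zero gives 0, this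
   excludes at once [s = 1], [s = -1] and a vanishing sum of Gegenbauer values. *)
have Mn : c k.+1 * ((1 + s) * ((G k.+1).[s] - (G k.+2).[s]) /
      ((1 - s) * ((G k.+1).[s] + (G k.+2).[s]))) != 0.
  by apply/eqP => z; move: ME; rewrite z subr0 => ME; rewrite ME ltxx in bM.
have s1 : 1 - s != 0 by apply: contraNneq Mn => ->; rewrite mul0r invr0 !mulr0.
have sN1 : 1 + s != 0 by apply: contraNneq Mn => ->; rewrite !mul0r mulr0.
have D0 : (G k.+1).[s] + (G k.+2).[s] != 0.
  by apply: contraNneq Mn => ->; rewrite mulr0 invr0 !mulr0.
have qs : c k.+1 * ((G k.+1).[s] - (G k.+2).[s]) = (1 - s) * (q k.+1).[s].
  have /(congr1 (horner^~ s)) := ultra_kernelE k.+1.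
  by rewrite hornerM hornerZ !(hornerD, hornerN) hornerC hornerX => ->.
have qNs : c k.+1 * ((G k.+1).[s] + (G k.+2).[s]) = (1 + s) * (qN k.+1).[s].
  have /(congr1 (horner^~ s)) := ultra_kernelN_E k.+1.
  by rewrite hornerM [(_ *: (G _ + _)).[_]]hornerZ !hornerD hornerC hornerX => ->.
have qN0 : (qN k.+1).[s] != 0.
  apply: contra_neq D0 => z; apply: (mulfI (lt0r_neq0 c0)).
  by rewrite qNs z !mulr0.
have {}ME : c k.+1 * (q k.+1).[s] / (qN k.+1).[s] = (q k.+1).[1] - M.
  rewrite -ME subKr; apply: (mulIf D0); apply: (mulIf s1); apply: (mulIf qN0).
  rewrite [RHS](_ : _ = (c k.+1 * ((G k.+1).[s] - (G k.+2).[s])) * ((1 + s) * (qN k.+1).[s])); last first.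
    by field; rewrite s1 D0.
  rewrite qs -qNs; field; exact: qN0.
(* [T.[s] = 0] fixes the ratio of the kernels at [s], which the two Christoffel-Darboux formulas
   have just identified with the fraction in the Levenshtein function. *)
have BE : c k.+1 * B = A * (M - (q k.+1).[1]).
  move: Ts; rewrite TE hornerD (hornerZ A) (hornerZ B) => Ts.
  rewrite -opprB -ME; apply: (mulIf qN0).
  rewrite [RHS](_ : _ = - c k.+1 * (A * (q k.+1).[s])); last by field.
  by rewrite -[A * _](addrK (B * (qN k.+1).[s])) Ts; ring.
have A0 : 0 < A.
  have := mulr_gt0 c0 lead; rewrite mulrDr BE [c _ * A]mulrC -mulrDr pmulr_lgt0//.
  by rewrite addr_gt0// subr_gt0.
have B0 : 0 < B by rewrite -(pmulr_rgt0 _ c0) BE mulr_gt0// subr_gt0.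
have R0 : 0 < (q k.+1).[1] by rewrite R1 ltr_wpDr// ltr0n bin_gt0 leq_addr.
have qN1 : (qN k.+1).[1] = c k.+1.
  by rewrite horner_ultra_kernelN ultra_kernel_atN1 mulrA sg2 mul1r.
have T1 : T.[1] = M * A.
  rewrite TE hornerD (hornerZ A) (hornerZ B) qN1 [B * _]mulrC BE; ring.
split.
- by rewrite T1 /A; field.
- by rewrite T1 mulr_gt0// (lt_trans R0).
- rewrite TE hornerD (hornerZ A) (hornerZ B) horner_ultra_kernelN opprK ultra_kernel_atN1.
  rewrite [X in 0 < X](_ : _ = ((-1) ^+ k.+1 * (-1) ^+ k.+1) * (A * c k.+1 + B * (q k.+1).[1])); last by ring.
  by rewrite sg2 mul1r addr_gt0// mulr_gt0.
- have -> : (-1) ^+ k.+1 * L ((1 - 'X) * T) = 2 * B by rewrite /B; field.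
  by rewrite mulr_gt0.
Qed.

End ultraspherical_functional.

(** * Quadrature *)

Lemma size_XsubCM (R : idomainType) c (p : {poly R}) : p != 0 ->
  size (('X - c%:P) * p) = (size p).+1.
Proof. by move=> p0; rewrite size_monicM ?monicXsubC// size_XsubC. Qed.

Section positive_functional.
Variables (R : realFieldType) (L : {poly R} -> R).
Hypothesis L_scalar : scalar L.
Hypothesis L_gt0 : forall p : {poly R}, p != 0 ->
  (forall t, -1 < t < 1 -> 0 <= p.[t]) -> 0 < L p.

Lemma signed_XsubC (x : R) : ~~ (-1 < x < 1) ->
  exists2 a : R, a != 0 & forall t, -1 < t < 1 -> 0 <= a * (t - x).
Proof.
rewrite negb_and -!leNgt => /orP[x1|x1]; [exists 1 | exists (-1)]; rewrite ?oppr_eq0 ?oner_eq0//.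
  by move=> t /andP[t1 _]; rewrite mul1r subr_ge0 ltW// (le_lt_trans x1).
by move=> t /andP[_ t1]; rewrite mulN1r opprB subr_ge0 ltW// (lt_le_trans t1).
Qed.

(* Orthogonality leaves room for at most one root outside [ ]-1, 1[ ], and the
   signs at the endpoints exclude a single one. *)
Lemma roots_in_itv (w : {poly R}) (rs : seq R) :
  w != 0 -> (forall t, -1 < t < 1 -> 0 <= w.[t]) ->
  let T := \prod_(x <- rs) ('X - x%:P) in
  (forall g : {poly R}, (size g < size rs)%N -> L (w * T * g) = 0) ->
  0 < T.[1] -> 0 < (-1) ^+ size rs * T.[-1] ->
  forall x, x \in rs -> -1 < x < 1.
Proof.
move=> w0 wge0 T To T1 TN1 x xrs; apply/negPn/negP => xout.
have [a a0 ax] := signed_XsubC xout.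
have rsE := perm_to_rem xrs; set rs1 := rem x rs in rsE.
have TE : T = ('X - x%:P) * \prod_(y <- rs1) ('X - y%:P).
  by rewrite /T (perm_big _ rsE) big_cons.
have in1 y : y \in rs1 -> -1 < y < 1.
  move=> yrs; apply/negPn/negP => yout.
  have [b b0 bx] := signed_XsubC yout.
  have rs1E := perm_to_rem yrs; set rs2 := rem y rs1 in rs1E.
  set g := \prod_(z <- rs2) ('X - z%:P).
  have {}TE : T = ('X - x%:P) * (('X - y%:P) * g) by rewrite TE (perm_big _ rs1E) big_cons.
  have g0 : g != 0 by apply: monic_neq0; exact: monic_prod_XsubC.
  have sg : (size g < size rs)%N.
    by rewrite size_prod_XsubC (perm_size rsE) /= (perm_size rs1E).
  (* [T * g] is [('X - x) ('X - y)] times a square: it has constant sign on []-1, 1[], although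
     orthogonality makes the integral vanish. *)
  have : 0 < L ((a * b) *: (w * T * g)).
    apply: L_gt0 => [|t t1].
      by rewrite scaler_eq0 !mulf_eq0 TE !mulf_eq0 !polyXsubC_eq0 !negb_or a0 b0 w0 g0.
    rewrite TE hornerZ !hornerM !hornerXsubC.
    rewrite [X in 0 <= X](_ : _ = (a * (t - x)) * (b * (t - y)) * w.[t] * (g.[t] ^+ 2)); last by ring.
    apply: mulr_ge0; last exact: sqr_ge0.
    apply: mulr_ge0; last exact: wge0.
    by apply: mulr_ge0; [exact: ax|exact: bx].
  by rewrite L_Z// To// mulr0 ltxx.
have p1 : 0 < (\prod_(y <- rs1) ('X - y%:P)).[1].
  rewrite horner_prod big_seq prodr_gt0// => y /in1/andP[_ y1].
  by rewrite hornerXsubC subr_gt0.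
have pN1 : 0 < (-1) ^+ size rs1 * (\prod_(y <- rs1) ('X - y%:P)).[-1].
  have -> : (-1) ^+ size rs1 * (\prod_(y <- rs1) ('X - y%:P)).[-1] = \prod_(y <- rs1) (1 + y).
    elim: (rs1) => [|y s IH]; first by rewrite !big_nil hornerC mulr1.
    by rewrite /= !big_cons hornerM hornerXsubC exprS -IH; ring.
  rewrite big_seq prodr_gt0// => y /in1/andP[y1 _].
  by rewrite -ltrBlDl sub0r.
case/negP: xout; apply/andP; split.
  move: TN1; rewrite (perm_size rsE) /= TE hornerM hornerXsubC exprS.
  rewrite [X in 0 < X](_ : _ = (1 + x) * ((-1) ^+ size rs1 * (\prod_(y <- rs1) ('X - y%:P)).[-1])); last by ring.
  by rewrite pmulr_lgt0// -ltrBlDl sub0r.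
by move: T1; rewrite TE hornerM hornerXsubC pmulr_lgt0// subr_gt0.
Qed.

Section quadrature.
Variables (r : nat) (alpha : 'I_r -> R) (M : R).
Hypothesis alpha_inj : injective alpha.
Let Z : {poly R} := \prod_i ('X - (alpha i)%:P).
Let l i : {poly R} := \prod_(j | j != i) ('X - (alpha j)%:P).

Lemma node_poly_split i : Z = ('X - (alpha i)%:P) * l i.
Proof. by rewrite /Z (bigD1 i). Qed.

Lemma lagrange_poly_at i : (l i).[alpha i] != 0.
Proof.
rewrite horner_prod; apply/prodf_neq0 => j ji; rewrite hornerXsubC subr_eq0.
by apply: contra ji => /eqP/alpha_inj ->.
Qed.

Lemma lagrange_poly_at_neq i j : j != i -> (l i).[alpha j] = 0.
Proof. by move=> ji; rewrite /l (bigD1 j)//= hornerM hornerXsubC subrr mul0r. Qed.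

Lemma node_poly_at i : Z.[alpha i] = 0.
Proof. by rewrite (node_poly_split i) hornerM hornerXsubC subrr mul0r. Qed.

Lemma size_node_poly : size Z = r.+1.
Proof. by rewrite size_prod_XsubC /index_enum -enumT size_enum_ord. Qed.

Lemma size_lagrange_poly i : size (l i) = r.
Proof.
have l0 : l i != 0 by apply/eqP => l0; have := lagrange_poly_at i; rewrite l0 horner0 eqxx.
by have := size_node_poly; rewrite (node_poly_split i) size_XsubCM// => -[].
Qed.

Lemma poly_eq_nodes (f g : {poly R}) : (size f <= r.+1)%N -> (size g <= r.+1)%N ->
  Z.[1] != 0 -> f.[1] = g.[1] -> (forall i, f.[alpha i] = g.[alpha i]) -> f = g.
Proof.
move=> sf sg Z1 fg1 fga; apply/eqP; rewrite -subr_eq0; apply/negPn/negP => fg0.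
have u : uniq (1 :: codom alpha).
  rewrite /= map_inj_uniq ?enum_uniq// andbT; apply/codomP => -[i a1].
  by rewrite a1 node_poly_at eqxx in Z1.
have rt : all (root (f - g)) (1 :: codom alpha).
  apply/allP => x; rewrite inE rootE hornerD hornerN => /predU1P[->|/codomP[i ->]].
    by rewrite fg1 subrr.
  by rewrite fga subrr.
have := max_poly_roots fg0 rt u; rewrite /= size_codom card_ord ltnNge.
by rewrite (leq_trans (size_polyD _ _))// geq_max sf size_polyN.
Qed.

(* Division by [(1 - 'X) * Z] reduces to degree at most [r], where the [r.+1]
   nodes [1] and [alpha i] determine the polynomial. *)
Lemma quadrature m (f : {poly R}) : Z.[1] != 0 -> L Z = Z.[1] / M ->
  (forall u : {poly R}, (size u <= m)%N -> L ((1 - 'X) * Z * u) = 0) ->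
  (size f <= r.+1 + m)%N ->
  L f = f.[1] / M + \sum_i (L (l i) - (l i).[1] / M) / (l i).[alpha i] * f.[alpha i].
Proof.
move=> Z1 LZ1 Zo sf.
pose W : {poly R} := ('X - 1%:P) * Z.
have Z0 : Z != 0 by apply/eqP => z; rewrite z horner0 eqxx in Z1.
have sW : size W = r.+2 by rewrite /W size_XsubCM// size_node_poly.
have W0 : W != 0 by rewrite -size_poly_gt0 sW.
pose u := f %/ W; pose v := f %% W.
have fE : f = u * W + v := divp_eq f W.
have su : (size u <= m)%N by rewrite size_divp// sW leq_subLR (leq_trans sf)// addnC.
have sv : (size v <= r.+1)%N by have := ltn_modp f W; rewrite W0 sW ltnS.
have Lf : L f = L v.
  rewrite fE L_D// (_ : u * W = - ((1 - 'X) * Z * u)); last by rewrite /W polyC1; ring.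
  by rewrite -scaleN1r L_Z// Zo// mulr0 add0r.
have f1 : f.[1] = v.[1] by rewrite fE hornerD !hornerM hornerXsubC subrr mul0r mulr0 add0r.
have fa i : f.[alpha i] = v.[alpha i].
  by rewrite fE hornerD !hornerM node_poly_at !mulr0 add0r.
(* The Lagrange polynomial corrected to vanish at the extra node 1. As [L Z = Z.[1] / M], its
   integral is the numerator of the Levenshtein weight. *)
pose e i : {poly R} := l i - ((l i).[1] / Z.[1]) *: Z.
have vE : v = (v.[1] / Z.[1]) *: Z + \sum_i (v.[alpha i] / (l i).[alpha i]) *: e i.
  apply: poly_eq_nodes => //.
  - rewrite (leq_trans (size_polyD _ _))// geq_max (leq_trans (size_scale_leq _ _)) ?size_node_poly//=.
    rewrite (leq_trans (size_sum _ _ _))//; apply/bigmax_leqP => i _.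
    rewrite (leq_trans (size_scale_leq _ _))// (leq_trans (size_polyD _ _))// geq_max.
    by rewrite size_lagrange_poly leqnSn size_polyN (leq_trans (size_scale_leq _ _))// size_node_poly.
  - rewrite hornerD hornerZ divfK// horner_sum big1 ?addr0// => i _.
    by rewrite hornerZ hornerD hornerN hornerZ divfK// subrr mulr0.
  - move=> i; rewrite hornerD hornerZ node_poly_at mulr0 add0r horner_sum (bigD1 i)//=.
    rewrite big1 ?addr0 => [|j ji].
      rewrite hornerZ hornerD hornerN hornerZ node_poly_at mulr0 subr0 divfK//.
      exact: lagrange_poly_at.
    rewrite hornerZ hornerD hornerN hornerZ node_poly_at (@lagrange_poly_at_neq j i) 1?eq_sym//.
    by rewrite !(mulr0, subr0).
rewrite Lf f1 {1}vE L_D// L_Z// LZ1 mulrA divfK// L_sum//; congr (_ + _).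
apply: eq_bigr => i _; rewrite fa L_Z// /e L_B// L_Z// LZ1 mulrA divfK//.
by rewrite mulrC -mulrA [_^-1 * _]mulrC mulrA.
Qed.

End quadrature.
End positive_functional.

(** * Hermite interpolation *)

Section derivative_within.
Context {R : realType}.

Lemma has_derivative_withinP (D : set R) (f : R -> R) (x l : R) :
  has_derivative_within D f x l <-> forall e, 0 < e -> exists2 d, 0 < d &
    forall y, D y -> y != x -> `|x - y| < d -> `|l - (f y - f x) / (y - x)| < e.
Proof.
split=> [h e e0|h].
  move/cvgrPdist_lt : h => /(_ _ e0) /nbhs_ballP[d /= d0 hd].
  by exists d => // y Dy yx xy; exact: hd.
apply/cvgrPdist_lt => e /h[d d0 hd]; apply/nbhs_ballP; exists d => //= y xy yx Dy.
exact: hd.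
Qed.

Lemma has_derivative_within_eq (D : set R) (f g : R -> R) (x l : R) : D x ->
  (forall y, D y -> f y = g y) ->
  has_derivative_within D f x l -> has_derivative_within D g x l.
Proof.
move=> Dx fg /has_derivative_withinP h; apply/has_derivative_withinP => e /h[d d0 hd].
by exists d => // y Dy yx xy; rewrite -!fg//; exact: hd.
Qed.

(** The difference quotient of [p] at [x] is itself a polynomial, whose value at [x] is the
    derivative. *)
Lemma has_derivative_within_subr_horner (D : set R) (f : R -> R) (p : {poly R}) (x l : R) :
  has_derivative_within D f x l ->
  has_derivative_within D (fun y => f y - p.[y]) x (l - p^`().[x]).
Proof.
move=> hf; pose q := (p - (p.[x])%:P) %/ ('X - x%:P).
have pE : p = q * ('X - x%:P) + (p.[x])%:P.
  apply/eqP; rewrite -subr_eq; apply/eqP; rewrite divpK// dvdp_XsubCl.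
  by rewrite rootE hornerD hornerN hornerC subrr.
have -> : p^`().[x] = q.[x].
  rewrite {1}pE derivD derivM derivXsubC derivC addr0 mulr1 hornerD hornerM.
  by rewrite hornerXsubC subrr mulr0 add0r.
have qc : q.[y] @[y --> within D x^'] --> q.[x].
  move=> P /(@continuous_horner R q x) hP.
  by apply: (@filterS _ (nbhs x) _ _ _ _ hP) => y Py _ _.
apply: cvg_trans (cvgB hf qc); apply: near_eq_cvg.
apply/nbhs_ballP; exists 1 => //= y _ yx _.
have y0 : y - x != 0 by rewrite subr_eq0.
rewrite !fctE [in RHS]pE !hornerD !hornerM !hornerXsubC !hornerC.
by field.
Qed.

Lemma has_derivative_within_interior (D : set R) (f : R -> R) (x l : R) :
  D° x -> has_derivative_within D f x l -> is_derive x 1 f l.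
Proof.
move=> /nbhs_ballP[d0 /= d00 hd0] /has_derivative_withinP h.
have hh : h^-1 *: ((f \o shift x) (h *: 1) - f x) @[h --> (0 : R)^'] --> l.
  apply/cvgrPdist_lt => e /h[d d_gt0 hd]; apply/nbhs_ballP.
  exists (Order.min d d0); first by rewrite /= lt_min d_gt0.
  move=> t /=; rewrite /ball/= sub0r normrN lt_min => /andP[td td0] t0.
  have xt : `|x - (t + x)| = `|t| by rewrite opprD addrCA subrr addr0 normrN.
  have := hd (t + x); rewrite xt => /(_ _ _ td).
  rewrite addrK /GRing.scale/= mulr1 mulrC; apply.
    by apply: hd0; rewrite /ball/= xt.
  by rewrite -subr_eq0 addrK.
apply: DeriveDef; first by apply/cvg_ex; exists l.
exact: cvg_lim hh.
Qed.

Lemma has_derivative_within_continuous (D : set R) (f : R -> R) (x l : R) :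
  D x -> has_derivative_within D f x l -> forall e, 0 < e -> exists2 d, 0 < d &
    forall y, D y -> `|x - y| < d -> `|f x - f y| < e.
Proof.
move=> Dx /has_derivative_withinP/(_ 1 ltr01)[d d0 hd] e e0.
have k0 : 0 < `|l| + 1 by rewrite ltr_wpDl.
exists (Order.min d (e / (`|l| + 1))); first by rewrite lt_min d0 divr_gt0.
move=> y Dy; rewrite lt_min => /andP[xd xe].
have [->|yx] := eqVneq y x; first by rewrite subrr normr0.
have y0 : y - x != 0 by rewrite subr_eq0.
rewrite distrC -[f y - f x](divfK y0) normrM.
have q : `|(f y - f x) / (y - x)| < `|l| + 1.
  rewrite -ltrBlDl; apply: le_lt_trans (hd _ Dy yx xd).
  by rewrite distrC; exact: lerB_dist.
move: xe; rewrite distrC ltr_pdivlMr// mulrC; apply: le_lt_trans.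
by rewrite ler_wpM2r// ltW.
Qed.

End derivative_within.

Section rolle_within.
Context {R : realType}.
Local Notation D := (`[(-1 : R), 1[%classic).

(** The one-sided derivative at -1 is harmless: at the endpoints of [[a, b]] only one-sided
    continuity is used. *)
Lemma rolle_within (f f' : R -> R) (a b : R) :
  (forall x, D x -> has_derivative_within D f x (f' x)) ->
  -1 <= a -> a < b -> b < 1 -> f a = f b -> exists2 c, a < c < b & f' c = 0.
Proof.
move=> hf a1 ab b1 fab.
have Dab x : a <= x <= b -> D x.
  by move=> /andP[ax xb]; rewrite /= in_itv/= (le_trans a1 ax) (le_lt_trans xb b1).
have df (x : R) : x \in `]a, b[ -> is_derive x 1 f (f' x).
  rewrite in_itv/= => /andP[ax xb].
  apply: (@has_derivative_within_interior _ D); last by apply: hf; apply: Dab; rewrite !ltW.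
  apply: (@filterS _ (nbhs x) _ `]a, b[%classic).
    by move=> y; rewrite /= in_itv/= => /andP[ay yb]; apply: Dab; rewrite !ltW.
  by apply: near_in_itvoo; rewrite in_itv/= ax.
have cont x e : a <= x <= b -> 0 < e -> exists2 d, 0 < d &
    forall y, a <= y <= b -> `|x - y| < d -> `|f x - f y| < e.
  move=> /Dab Dx e0; have [d d0 hd] := has_derivative_within_continuous Dx (hf _ Dx) e0.
  by exists d => // y /Dab; exact: hd.
have cf : {within `[a, b], continuous f}.
  apply: derivable_oo_LRcontinuous_within; split.
  - by move=> x /df [].
  - apply/cvgrPdist_lt => e e0.
    have [|d d0 hd] := cont a e _ e0; first by rewrite lexx ltW.
    apply/nbhs_ballP; exists (Order.min d (b - a)); first by rewrite /= lt_min d0 subr_gt0.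
    move=> y; rewrite /ball/= lt_min => /andP[yd yb] ay; apply: hd => //.
    by move: yb; rewrite ltr_norml; lra.
  - apply/cvgrPdist_lt => e e0.
    have [|d d0 hd] := cont b e _ e0; first by rewrite lexx ltW.
    apply/nbhs_ballP; exists (Order.min d (b - a)); first by rewrite /= lt_min d0 subr_gt0.
    move=> y; rewrite /ball/= lt_min => /andP[yd yb] ay; apply: hd => //.
    by move: yb; rewrite ltr_norml; lra.
have [c cab [_ fc0]] := Rolle ab (fun x xab => @ex_derive _ _ _ _ _ _ _ (df x xab)) cf fab.
exists c; first by move: cab; rewrite in_itv.
by have [_ <-] := df c cab.
Qed.

(** The new zeros avoid [s], so they can later be joined to zeros of the derivative prescribed at
    double nodes without repetition. *)
Lemma rolle_zeros (f f' : R -> R) (s : seq R) :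
  (forall x, D x -> has_derivative_within D f x (f' x)) ->
  uniq s -> (forall x, x \in s -> D x /\ f x = 0) ->
  exists s' : seq R, [/\ uniq s', size s' = (size s).-1,
    forall x, x \in s' -> -1 < x < 1 /\ f' x = 0 & forall x, x \in s' -> x \notin s].
Proof.
move=> hf us sz; set s0 := sort <=%O s.
have ss0 : s0 =i s by move=> x; rewrite mem_sort.
have : sorted <%O s0 by rewrite sort_lt_sorted.
have : forall x, x \in s0 -> D x /\ f x = 0 by move=> x; rewrite ss0; exact: sz.
have -> : size s = size s0 by rewrite size_sort.
(* In the induction all new zeros lie to the right of the head, hence differ from the zero found
   before the next head. *)
suff H x t : (forall y, y \in x :: t -> D y /\ f y = 0) -> path <%O x t ->
    exists s' : seq R, [/\ uniq s', size s' = size t,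
      forall y, y \in s' -> -1 < y < 1 /\ f' y = 0 &
      forall y, y \in s' -> x < y /\ y \notin x :: t].
  case: s0 ss0 => [|x t] ss0 /=; first by move=> _ _; exists [::].
  move=> /H /[apply] -[s' [us' ssz s'z s'n]]; exists s'; split=> // y /s'n[_].
  by rewrite ss0.
elim: t x {us sz s0 ss0} => [|y t IH] x xz /=; first by move=> _; exists [::].
move=> /andP[xy yt].
have [|s' [us' ss' s'z s'n]] := IH y _ yt.
  by move=> z zt; apply: xz; rewrite inE zt orbT.
have [Dx fx] : D x /\ f x = 0 by apply: xz; rewrite inE eqxx.
have [Dy fy] : D y /\ f y = 0 by apply: xz; rewrite !inE eqxx orbT.
have x1 : -1 <= x by move: Dx; rewrite /= in_itv/= => /andP[].
have y1 : y < 1 by move: Dy; rewrite /= in_itv/= => /andP[].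
have [|c /andP[xc cy] fc] := rolle_within hf x1 xy y1; first by rewrite fx fy.
have ty z : z \in t -> y < z.
  by move: yt; rewrite lt_path_sortedE => /andP[/allP ty _] /ty.
exists (c :: s'); split=> /=.
- rewrite us' andbT; apply/negP => /s'n[yc _].
  by have := lt_trans yc cy; rewrite ltxx.
- by rewrite ss'.
- move=> z; rewrite inE => /predU1P[->|/s'z//]; split=> //.
  by rewrite (le_lt_trans x1 xc) (lt_trans cy).
- move=> z; rewrite inE => /predU1P[->|zs'].
    split=> //; rewrite !inE !negb_or gt_eqF// lt_eqF//=.
    by apply/negP => /ty yc; have := lt_trans yc cy; rewrite ltxx.
  have [yz znt] := s'n z zs'; split; first exact: lt_trans yz.
  by rewrite inE negb_or znt andbT gt_eqF// (lt_trans xy).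
Qed.

Lemma nth_derivative_zeros m (f g : R -> R) n (s : seq R) :
  is_nth_derivative D m f g -> uniq s -> size s = (m + n)%N ->
  (forall x, x \in s -> D x /\ f x = 0) ->
  exists s' : seq R, [/\ uniq s', size s' = n & forall x, x \in s' -> D x /\ g x = 0].
Proof.
elim: m g n => [|m IH] g n /=.
  move=> gf us ss sz; exists s; split=> // x /sz[Dx fx]; split=> //.
  by rewrite gf.
move=> [f' [ff' f'g]] us ss sz.
have [|s1 [us1 ss1 s1z]] := IH f' n.+1 ff' us _ sz; first by rewrite ss addnS.
have [s' [us' ss' s'z _]] := rolle_zeros f'g us1 s1z.
exists s'; split=> //; first by rewrite ss' ss1.
by move=> x /s'z[/andP[x1 x2] gx]; split=> //=; rewrite in_itv/= x2 ltW.
Qed.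

(** The definition peels off the last derivative; Hermite data and the first application of Rolle
    need the first one. *)
Lemma is_nth_derivativeSl m (f g : R -> R) : is_nth_derivative D m.+1 f g ->
  exists2 f1 : R -> R, forall x, D x -> has_derivative_within D f x (f1 x) &
    is_nth_derivative D m f1 g.
Proof.
elim: m g => [|m IH] g [f' [ff' f'g]].
  exists g => // x Dx.
  by apply: (has_derivative_within_eq Dx _ (f'g x Dx)) => y Dy; exact: ff'.
by have [f1 hf1 f1f'] := IH f' ff'; exists f1 => //; exists f'.
Qed.

Lemma is_nth_derivative_subr_horner m (f g : R -> R) (p : {poly R}) :
  is_nth_derivative D m f g ->
  is_nth_derivative D m (fun x => f x - p.[x]) (fun x => g x - p^`(m).[x]).
Proof.
elim: m g => [|m IH] g /=; first by move=> gf x Dx; rewrite gf.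
move=> [f' [ff' f'g]]; exists (fun x => f' x - p^`(m).[x]); split; first exact: IH.
by move=> x Dx; apply: has_derivative_within_subr_horner; exact: f'g.
Qed.

End rolle_within.

Lemma derivn_monic (R : nzRingType) n (p : {poly R}) :
  p \is monic -> size p = n.+1 -> p^`(n) = n`!%:R%:P.
Proof.
move=> /monicP pm sp; apply/polyP => i; rewrite coef_derivn coefC.
case: i => [|i] /=; last by rewrite nth_default ?mul0rn// sp addnS ltnS leq_addr.
by rewrite addn0 ffactnn; move: pm; rewrite lead_coefE sp /= => ->.
Qed.

Lemma lagrange_interpolation (R : realFieldType) r (alpha : 'I_r -> R) (y : 'I_r -> R) :
  injective alpha ->
  exists2 p : {poly R}, (size p <= r)%N & forall i, p.[alpha i] = y i.
Proof.
move=> ai; pose l i : {poly R} := \prod_(j | j != i) ('X - (alpha j)%:P).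
exists (\sum_i (y i / (l i).[alpha i]) *: l i).
  rewrite (leq_trans (size_sum _ _ _))//; apply/bigmax_leqP => i _.
  by rewrite (leq_trans (size_scale_leq _ _))// (size_lagrange_poly ai).
move=> i; rewrite horner_sum (bigD1 i)//= big1 ?addr0.
  by rewrite hornerZ divfK// (lagrange_poly_at ai).
move=> j ji; rewrite hornerZ (@lagrange_poly_at_neq _ _ alpha j i) ?mulr0//.
by rewrite eq_sym.
Qed.

Section hermite.
Context {R : realType}.
Local Notation D := (`[(-1 : R), 1[%classic).
Variables (r : nat) (alpha : 'I_r -> R) (dbl : pred 'I_r).
Hypothesis alpha_inj : injective alpha.
Let Z : {poly R} := \prod_i ('X - (alpha i)%:P).
Let V : {poly R} := \prod_(i | dbl i) ('X - (alpha i)%:P).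

(** Adding [Z * q] to the Lagrange interpolant keeps its values and changes its derivative at a node
    by [Z'] times [q]; so [q] is again found by Lagrange interpolation, on the double nodes. *)
Lemma hermite_interpolation (y y' : 'I_r -> R) :
  exists p : {poly R}, [/\ (size p <= r + #|dbl|)%N,
    forall i, p.[alpha i] = y i & forall i, dbl i -> p^`().[alpha i] = y' i].
Proof.
have [p0 sp0 p0y] := lagrange_interpolation y alpha_inj.
have dZ i : Z^`().[alpha i] = (\prod_(j | j != i) ('X - (alpha j)%:P)).[alpha i].
  rewrite /Z (node_poly_split alpha i) derivM derivXsubC mul1r hornerD hornerM.
  by rewrite hornerXsubC subrr mul0r addr0.
have bi : injective (fun i : 'I_#|dbl| => alpha (enum_val i)).
  by move=> i j /alpha_inj/enum_val_inj.
have [q sq qy] := lagrange_interpolation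
  (fun i => (y' (enum_val i) - p0^`().[alpha (enum_val i)]) / Z^`().[alpha (enum_val i)]) bi.
exists (p0 + Z * q); split.
- rewrite (leq_trans (size_polyD _ _))// geq_max (leq_trans sp0 (leq_addr _ _))/=.
  rewrite (leq_trans (size_polyMleq _ _))// /Z size_node_poly.
  by rewrite -subn1 leq_subLR add1n addSn ltnS leq_add2l.
- by move=> i; rewrite hornerD hornerM /Z node_poly_at mul0r addr0.
- move=> i di; rewrite derivD derivM !(hornerD, hornerM) [Z.[_]]node_poly_at mul0r addr0.
  have /= := qy (enum_rank_in di i); rewrite enum_rankK_in// => ->.
  have : Z^`().[alpha i] != 0 by rewrite dZ (lagrange_poly_at alpha_inj).
  by move: Z^`().[alpha i] p0^`().[alpha i] (y' i) => a b c a0; field.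
Qed.

(** Choose [c] so that [phi = f - p - c w] also vanishes at [t]. Rolle gives [r] zeros of [phi'] off
    the nodes, the double nodes give the rest of [m + 1], and [m] further derivatives leave a point
    where [g = c (m+1)!]. So [c >= 0], while [w.[t] > 0] because simple nodes lie to the left of
    [t]. *)
Lemma hermite_le m (f g : R -> R) (p : {poly R}) (f1 : R -> R) :
  (r + #|dbl| = m.+1)%N -> (forall i, D (alpha i)) ->
  (forall i, ~~ dbl i -> forall t, D t -> alpha i <= t) ->
  (forall x, D x -> has_derivative_within D f x (f1 x)) ->
  is_nth_derivative D m f1 g -> (forall t, D t -> 0 <= g t) ->
  (size p <= m.+1)%N -> (forall i, p.[alpha i] = f (alpha i)) ->
  (forall i, dbl i -> p^`().[alpha i] = f1 (alpha i)) ->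
  forall t, D t -> p.[t] <= f t.
Proof.
move=> mE aD adbl hf1 f1g g0 sp pa p'a t Dt.
have [/codomP[i ->]|tn] := boolP (t \in codom alpha); first by rewrite pa.
pose w := Z * V.
have wt0 : 0 < w.[t].
  have ZV : w.[t] = \prod_(i | ~~ dbl i) (t - alpha i) * V.[t] ^+ 2.
    rewrite hornerM /Z (bigID dbl)/= hornerM -/V expr2 !horner_prod.
    under [X in _ * X * _]eq_bigr do rewrite hornerXsubC.
    by rewrite mulrAC mulrC.
  have ta i : t - alpha i != 0.
    by rewrite subr_eq0; apply: contraNneq tn => ->; exact: codom_f.
  rewrite ZV mulr_gt0//.
    apply: prodr_gt0 => i di; rewrite lt_neqAle eq_sym ta subr_ge0.
    exact: adbl.
  rewrite exprn_even_gt0//= horner_prod; apply/prodf_neq0 => i _.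
  by rewrite hornerXsubC.
pose c := (f t - p.[t]) / w.[t].
suff c0 : 0 <= c by rewrite -subr_ge0 -(pmulr_lge0 _ (_ : 0 < w.[t]^-1)) ?invr_gt0.
pose P := p + c *: w.
pose phi x := f x - P.[x]; pose phi1 x := f1 x - P^`().[x].
have hphi x : D x -> has_derivative_within D phi x (phi1 x).
  by move=> Dx; apply: has_derivative_within_subr_horner; exact: hf1.
have wa i : w.[alpha i] = 0 by rewrite hornerM /Z node_poly_at mul0r.
have uz : uniq (t :: codom alpha) by rewrite /= tn map_inj_uniq// enum_uniq.
have [|s [us ss sz sn]] := rolle_zeros hphi uz.
  move=> x; rewrite inE => /predU1P[->|/codomP[i ->]].
    by split=> //; rewrite /phi /P hornerD hornerZ divfK ?gt_eqF//; ring.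
  by split=> //; rewrite /phi /P hornerD hornerZ wa mulr0 addr0 pa subrr.
pose ds := [seq alpha i | i in dbl].
have szs : size (s ++ ds) = (m + 1)%N.
  by rewrite size_cat ss /= size_codom card_ord size_image mE addn1.
have us' : uniq (s ++ ds).
  rewrite cat_uniq us/= map_inj_uniq ?enum_uniq ?andbT//.
  apply/hasPn => x /mapP[i _ ->]; apply/negP => /sn.
  by rewrite inE codom_f orbT.
have nd : is_nth_derivative D m phi1 (fun x => g x - P^`(m.+1).[x]).
  rewrite (_ : (fun x => g x - P^`(m.+1).[x]) = (fun x => g x - (P^`())^`(m).[x])).
    exact: is_nth_derivative_subr_horner.
  by apply/funext => x; rewrite derivSn.
have [|s' [_ ss' s'z]] := nth_derivative_zeros nd us' szs.
  move=> x; rewrite mem_cat => /orP[/sz[/andP[x1 x2] x0]|/mapP[i]].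
    by split=> //=; rewrite in_itv/= x2 ltW.
  rewrite mem_enum => di ->.
  split=> //; rewrite /phi1 /P derivD derivZ hornerD hornerZ p'a//.
  have -> : w^`().[alpha i] = 0; last by rewrite mulr0 addr0 subrr.
  rewrite derivM hornerD !hornerM [Z.[_]]node_poly_at mul0r addr0.
  by rewrite /V (bigD1 i)//= hornerM hornerXsubC subrr mul0r mulr0.
case: s' ss' s'z => [//|x s'] _ s'z; have [Dx /eqP] := s'z x (mem_head _ _).
have wm : w \is monic by rewrite rpredM ?monic_prod_XsubC.
have sw : size w = m.+2.
  rewrite size_monicM ?monic_neq0 ?monic_prod_XsubC//.
  have -> : V = \prod_(a <- ds) ('X - a%:P) by rewrite /ds big_image.
  by rewrite size_node_poly size_prod_XsubC size_image addSn addnS mE.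
rewrite /P derivnD derivnZ (derivn_monic wm sw) (derivn_poly0 sp) add0r hornerZ hornerC.
rewrite subr_eq0 => /eqP gx; have := g0 x Dx; rewrite gx.
by rewrite pmulr_lge0// ltr0n fact_gt0.
Qed.

End hermite.

(** * Designs and Levenshtein nodes *)

Section gegenbauer_functional.
Variables (R : realType) (d : nat).
Local Notation L := (@mu_int R d.+2).

Let Ls : scalar L := mu_int_is_scalar (isT : (2 <= d.+2)%N).
Let L1 : L 1 = 1 := mu_int1 (isT : (2 <= d.+2)%N).
Let Lp p : L ((1 - 'X^2) * p^`()) = d.+1%:R * L ('X * p).
Proof. by rewrite mu_int_parts// -(natr1 d.+1) addrK. Qed.
Let Lgt0 (p : {poly R}) : p != 0 ->
  (forall t, -1 < t < 1 -> 0 <= p.[t]) -> 0 < L p.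
Proof. exact: mu_int_gt0. Qed.

Lemma wint_mulE (p q : {poly R}) :
  wint (mu_density d.+2) (fun t => p.[t] * q.[t]) = L (p * q).
Proof. by rewrite /mu_int; congr wint; apply/funext => t; rewrite hornerM. Qed.

(** The solution of the recurrence shows that the choice is not the default; uniqueness then
    identifies the chosen polynomial. *)
Lemma gegenbauerE i : gegenbauer d.+2 i = ultra R d i.
Proof.
rewrite /gegenbauer /orthogonal_poly; set A := [set p : {poly R} | _].
have : A (xget 0 A).
  apply: (@xgetPex _ 0 A); exists (ultra R d i); split.
  - exact: size_ultra.
  - exact: ultra_at1.
  - by move=> q qi; rewrite wint_mulE (L_ultra_orth Ls Lp).
move=> [sz at1 orth].
apply: (orthogonal_ultra Ls Lp Lgt0 sz at1) => q qi.
by rewrite -wint_mulE; exact: orth.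
Qed.

Lemma L_expansion0 m (c : nat -> R) : L (\sum_(i < m.+1) c i *: ultra R d i) = c 0%N.
Proof.
rewrite (L_sum Ls) big_ord_recl big1 ?addr0.
  by rewrite (L_Z Ls) ultra0 L1 mulr1.
by move=> i _; rewrite (L_Z Ls) (L_ultraS Ls Lp) mulr0.
Qed.

Lemma gegenbauer_coefs0 (f : {poly R}) : gegenbauer_coefs d.+2 f 0 = L f.
Proof.
rewrite /gegenbauer_coefs; set A := [set c : nat -> R | _].
have : A (xget (fun=> 0) A).
  apply: (@xgetPex _ _ A); have [c fE c0] := ultra_expand d (leqnn (size f)).
  exists c; split=> //; rewrite {1}fE.
  by apply: eq_bigr => i _; rewrite gegenbauerE.
(* For [f = 0] the expansion is empty, and the coefficient is 0 by the clause on indices beyond the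
   size. *)
move: (xget _ _) => c [fE c0]; case sf : (size f) => [|m].
  rewrite c0 ?sf//; move/eqP : sf; rewrite size_poly_eq0 => /eqP ->.
  by rewrite (L_0 Ls).
rewrite [in RHS]fE sf; under eq_bigr do rewrite gegenbauerE.
by rewrite L_expansion0.
Qed.

Lemma design_mean N tau (C : 'I_N -> 'rV[R]_d.+2) (W : 'I_N -> R) (f : {poly R}) :
  weighted_design tau C W -> (size f <= tau.+1)%N ->
  \sum_(i < N) \sum_(j < N) W i * W j * f.[dotv (C i) (C j)] = L f.
Proof.
move=> [[_ _ _ W1] M0] sf.
have [c -> _] := ultra_expand d sf; rewrite L_expansion0.
have -> : \sum_(i < N) \sum_(j < N) W i * W j *
      (\sum_(l < tau.+1) c l *: ultra R d l).[dotv (C i) (C j)] =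
    \sum_(l < tau.+1) c l * moment C W l.
  under [RHS]eq_bigr do rewrite /moment mulr_sumr.
  rewrite [RHS]exchange_big/=; apply: eq_bigr => i _.
  under [RHS]eq_bigr do rewrite mulr_sumr.
  rewrite [RHS]exchange_big/=; apply: eq_bigr => j _.
  rewrite horner_sum mulr_sumr; apply: eq_bigr => l _.
  by rewrite hornerZ gegenbauerE mulrCA.
rewrite big_ord_recl big1 ?addr0 => [|l _]; last by rewrite M0 ?mulr0//= ltn_ord.
rewrite /moment gegenbauerE ultra0.
under eq_bigr => i _ do under eq_bigr => j _ do rewrite hornerC mulr1.
under eq_bigr => i _ do rewrite -mulr_sumr W1 mulr1.
by rewrite W1 mulr1.
Qed.

Lemma dotv_sphere_itv (x y : 'rV[R]_d.+2) : sphere x -> sphere y -> x != y ->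
  -1 <= dotv x y < 1.
Proof.
have dotE (z : 'rV[R]_d.+2) : sphere z -> dotv z z = 1.
  have z0 : 0 <= dotv z z by apply: sumr_ge0 => i _; rewrite -expr2 sqr_ge0.
  by rewrite /sphere/= => z1; rewrite -[LHS]sqr_sqrtr// z1 expr1n.
move=> /dotE x1 /dotE y1 xy.
(* The squared norm of [x + a y]: [a = 1] gives the lower bound and [a = -1] the upper one, where
   equality forces [x = y]. *)
have sq (a : R) : \sum_i (x 0 i + a * y 0 i) ^+ 2 = 1 + 2 * a * dotv x y + a ^+ 2.
  have -> : 1 + 2 * a * dotv x y + a ^+ 2 = dotv x x + 2 * a * dotv x y + a ^+ 2 * dotv y y.
    by rewrite x1 y1 mulr1.
  rewrite /dotv !mulr_sumr -!big_split/=.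
  by apply: eq_bigr => i _; ring.
apply/andP; split.
  have : 0 <= \sum_i (x 0 i + 1 * y 0 i) ^+ 2 by apply: sumr_ge0 => i _; rewrite sqr_ge0.
  by rewrite sq; lra.
rewrite lt_neqAle; apply/andP; split.
  apply: contra xy => /eqP xy1; have := sq (-1); rewrite xy1.
  rewrite [X in _ = X -> _](_ : _ = 0); last by ring.
  move/psumr_eq0P => z; apply/eqP/rowP => i.
  have /eqP := z (fun i _ => sqr_ge0 _) i isT.
  by rewrite sqrf_eq0 mulN1r subr_eq0 => /eqP.
have : 0 <= \sum_i (x 0 i + -1 * y 0 i) ^+ 2 by apply: sumr_ge0 => i _; rewrite sqr_ge0.
by rewrite sq; lra.
Qed.

(** The linear programming bound: the full double sum of [f] is [L f] by the design property, and
    its diagonal is the subtracted term. *)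
Lemma energy_lower_bound N tau (C : 'I_N -> 'rV[R]_d.+2) (W : 'I_N -> R)
    (h : R -> \bar R) (f : {poly R}) :
  weighted_design tau C W -> (size f <= tau.+1)%N ->
  (forall t, -1 <= t < 1 -> (f.[t]%:E <= h t)%E) ->
  ((L f - f.[1] * \sum_(i < N) W i ^+ 2)%:E <= energy h C W)%E.
Proof.
move=> WD sf fh; have [[Cs Ci W0 _] _] := WD.
rewrite -(design_mean WD sf) mulr_sumr -sumrB -sumEFin.
apply: lee_sum => i _.
rewrite (bigD1 i)//= (_ : dotv (C i) (C i) = 1).
  rewrite -expr2 mulrC addrC addrK -sumEFin.
  rewrite (eq_bigl (fun j => i != j)); last by move=> j; rewrite eq_sym.
  apply: lee_sum => j ij; rewrite EFinM; apply: lee_wpmul2l.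
    by rewrite lee_fin ltW// mulr_gt0.
  apply/fh/dotv_sphere_itv => //; by apply: contra_neq ij => /Ci.
have := Cs i; rewrite /sphere/= => z1; rewrite -[LHS]sqr_sqrtr ?z1 ?expr1n//.
by apply: sumr_ge0 => j _; rewrite -expr2 sqr_ge0.
Qed.

End gegenbauer_functional.

(** * Location of the Levenshtein nodes, quadrature and positivity of the weights *)

Section levenshtein_nodes.
Variables (R : realType) (d k : nat) (e : bool) (s M : R).
Variable alpha : 'I_(k.+1 + e) -> R.
Local Notation L := (@mu_int R d.+2).
Hypothesis alpha_inj : injective alpha.
Hypothesis alpha_root : forall t : R,
  root (levenshtein_poly d.+2 k.+1 e s) t <-> exists i, alpha i = t.

Let Ls : scalar L := mu_int_is_scalar (isT : (2 <= d.+2)%N).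
Let L1 : L 1 = 1 := mu_int1 (isT : (2 <= d.+2)%N).
Let Lp p : L ((1 - 'X^2) * p^`()) = d.+1%:R * L ('X * p).
Proof. by rewrite mu_int_parts// -(natr1 d.+1) addrK. Qed.
Let Lgt0 (p : {poly R}) : p != 0 ->
  (forall t, -1 < t < 1 -> 0 <= p.[t]) -> 0 < L p.
Proof. exact: mu_int_gt0. Qed.

Local Notation Z := (\prod_i ('X - (alpha i)%:P)).
Let b1X : {poly R} := (1 + 'X) ^+ e.

Let onepX : (1 + 'X : {poly R}) = 'X - (-1)%:P.
Proof. by rewrite polyCN opprK addrC. Qed.

Let b1X_monic : b1X \is monic.
Proof. by rewrite monic_exp// onepX monicXsubC. Qed.

Let size_b1X : size b1X = e.+1.
Proof. by rewrite /b1X onepX; case: e; rewrite ?expr1 ?size_XsubC// expr0 size_poly1. Qed.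

Let b1X_odd : e = false -> b1X = 1.
Proof. by rewrite /b1X => ->. Qed.

Let b1X_even : e = true -> b1X = 'X - (-1)%:P.
Proof. by rewrite /b1X => ->; rewrite expr1 onepX. Qed.

Let horner_b1X t : b1X.[t] = (1 + t) ^+ e.
Proof. by rewrite /b1X horner_exp hornerD hornerX hornerC. Qed.

(* Finiteness of the root set forces the kernel to exist and to be nonzero, and
   the number of roots forces it to have degree exactly [k]. *)
Lemma levenshtein_node_factor : exists T : {poly R},
  [/\ T \is monic, size T = k.+2, T.[s] = 0, Z = b1X * T &
    forall g : {poly R}, (size g <= k)%N -> L ((1 - 'X) * b1X * T * g) = 0].
Proof.
pose K := reproducing_kernel
  (fun t => (1 - t) * (1 + t) ^+ e * mu_density d.+2 t) k.+1 s.
pose G := b1X * ('X - s%:P) * K.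
have lE : levenshtein_poly d.+2 k.+1 e s = (lead_coef (G * K))^-1 *: (G * K).
  by rewrite /levenshtein_poly /G -mulrA expr2 !mulrA.
have Z0 : Z != 0 by apply: monic_neq0; exact: monic_prod_XsubC.
have K0 : K != 0.
  apply/eqP => K0; have [t _ /negP] := exists_nonroot_itv Z0; apply.
  have : root (levenshtein_poly d.+2 k.+1 e s) t.
    by rewrite lE K0 mulr0 scaler0 root0.
  by move=> /alpha_root[i <-]; rewrite node_poly_at.
have [sK Kr] : (size K <= k.+1)%N /\ forall q : {poly R}, (size q <= k.+1)%N ->
    L ((1 - 'X) * b1X * K * q) = q.[s].
  move: K0; rewrite /K /reproducing_kernel.
  case: xgetP => [p -> [sp pr] _|_]; last by rewrite eqxx.
  split=> // q sq; rewrite -(pr q sq) /mu_int /wint.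
  apply: eq_Rintegral => t _; rewrite !hornerM horner_b1X hornerD hornerN hornerX hornerC.
  by ring.
have G0 : G != 0.
  by rewrite !mulf_neq0 ?polyXsubC_eq0//; exact: monic_neq0.
have rG : all (root G) (codom alpha).
  apply/allP => _ /codomP[i ->].
  have : root (levenshtein_poly d.+2 k.+1 e s) (alpha i) by apply/alpha_root; exists i.
  rewrite lE rootZ; last by rewrite invr_eq0 lead_coef_eq0 mulf_neq0.
  by rewrite rootM => /orP[//|rK]; rewrite rootM rK orbT.
have ua : uniq_roots (codom alpha) by rewrite uniq_rootsE map_inj_uniq ?enum_uniq.
have sG : size G = (size (codom alpha)).+1.
  apply/eqP; rewrite eqn_leq andbC max_poly_roots//; last by rewrite -uniq_rootsE.
  rewrite size_codom card_ord (leq_trans (size_polyMleq _ _))//.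
  rewrite (size_monicM b1X_monic) ?polyXsubC_eq0// size_b1X size_XsubC.
  by rewrite addn2 /= addSn/= addnC; apply: leq_add.
have GE : G = lead_coef G *: Z.
  rewrite {1}(all_roots_prod_XsubC sG rG ua); congr (_ *: _).
  by rewrite /codom big_image.
have c0 : lead_coef G != 0 by rewrite lead_coef_eq0.
exists ((lead_coef G)^-1 *: (('X - s%:P) * K)); set T := _ *: _.
have ZE : Z = b1X * T.
  by rewrite /T -scalerAr mulrA -/G GE lead_coefZ (monicP (monic_prod_XsubC _ _ _)) mulr1 scalerA mulVf// scale1r.
have Tm : T \is monic by rewrite -(monicMl _ b1X_monic) -ZE monic_prod_XsubC.
split=> //.
- have := size_node_poly alpha; rewrite ZE size_monicM ?monic_neq0// size_b1X.
  by rewrite addSn /= addnC -addSn => /addIn.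
- by rewrite hornerZ hornerM hornerXsubC subrr mul0r mulr0.
- move=> g sg; rewrite /T.
  (* The factor ['X - s] is moved to the test polynomial, which then vanishes at the point [s] where
     [K] reproduces. *)
  rewrite (_ : _ * g = (lead_coef G)^-1 *: ((1 - 'X) * b1X * K * (('X - s%:P) * g))); last first.
    by rewrite -!mul_polyC; ring.
  rewrite (L_Z Ls) Kr; first by rewrite hornerM hornerXsubC subrr mul0r mulr0.
  have [->|g0] := eqVneq g 0; first by rewrite mulr0 size_poly0.
  by rewrite size_XsubCM// ltnS.
Qed.

Hypothesis delsarte_lt : (delsarte_bound d.+2 (2 * k.+1 - 1 + e))%:R < M.
Hypothesis levenshteinE : levenshtein_fun d.+2 k.+1 e s = M.

Lemma levenshtein_node_signs (T : {poly R}) :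
  T \is monic -> size T = k.+2 -> T.[s] = 0 ->
  (forall g : {poly R}, (size g <= k)%N -> L ((1 - 'X) * b1X * T * g) = 0) ->
  [/\ (b1X * T).[1] = M * L (b1X * T), 0 < T.[1], 0 < (-1) ^+ k.+1 * T.[-1] &
      e -> 0 < (-1) ^+ k.+1 * L ((1 - 'X) * T)].
Proof.
move=> Tm sT Ts To.
have n1 : (d.+2)%:R - 1 = d.+1%:R :> R by rewrite -(natr1 d.+1) addrK.
have dk : ((2 * k.+1 - 1 + e).+1)./2 = k.+1 by case: (e) => /=; lia.
have de : ~~ odd (2 * k.+1 - 1 + e) = e.
  rewrite (_ : (2 * k.+1 - 1 + e = k.*2.+1 + e)%N); last by rewrite mul2n doubleS; lia.
  by rewrite oddD /= odd_double; case: (e).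
move: delsarte_lt levenshteinE.
rewrite /delsarte_bound /levenshtein_fun dk de !gegenbauerE n1.
move: To; rewrite /b1X; case: (e) => /= To.
- rewrite expr1 in To *.
  have -> : (d.+2 + k.+1 + 1 - 2 = d.+1 + k.+1)%N by lia.
  have -> : (d.+2 + k.+1 - 2 = d.+1 + k)%N by lia.
  have -> : (k.+1 + d.+2 + 1 - 3 = d + k.+1)%N by lia.
  have -> : (d.+2 - 1 = d.+1)%N by lia.
  have -> : (d.+2 - 2 = d)%N by lia.
  have -> : (k.+1 - 1 + 1 = k.+1)%N by lia.
  have -> : (k.+1 + 1 = k.+2)%N by lia.
  have -> : (2 * k.+1 + d.+2 + 2 * 1)%:R - 3 = (2 * k.+1 + d.+1)%:R :> R.
    by rewrite (_ : (2 * k.+1 + d.+2 + 2 * 1 = (2 * k.+1 + d.+1) + 3)%N) ?natrD ?addrK//; lia.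
  rewrite natrD expr1 mul1r => bM ME.
  have To' (g : {poly R}) : (size g <= k)%N -> L ((1 - 'X^2) * T * g) = 0.
    by move=> /To <-; rewrite -[X in X - 'X^2](expr1n _ 2) subr_sqr.
  have [E1 E2 E3 E4] := node_poly_even Ls L1 Lp Lgt0 Tm sT Ts To' bM ME.
  split=> //; rewrite -E1 hornerM hornerD hornerX hornerC; ring.
- rewrite expr0 in To *.
  have -> : (d.+2 + k.+1 + 0 - 2 = d.+1 + k)%N by lia.
  have -> : (d.+2 + k.+1 - 2 = d.+1 + k)%N by lia.
  have -> : (k.+1 + d.+2 + 0 - 3 = d + k)%N by lia.
  have -> : (d.+2 - 1 = d.+1)%N by lia.
  have -> : (d.+2 - 2 = d)%N by lia.
  have -> : (k.+1 - 1 + 0 = k)%N by lia.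
  have -> : (k.+1 + 0 = k.+1)%N by lia.
  have -> : (2 * k.+1 + d.+2 + 2 * 0)%:R - 3 = (2 * k + d.+1)%:R :> R.
    by rewrite (_ : (2 * k.+1 + d.+2 + 2 * 0 = (2 * k + d.+1) + 3)%N) ?natrD ?addrK//; lia.
  rewrite addnn -mul2n natrM expr0 mul1r mul0r add0r => bM ME.
  have To' (g : {poly R}) : (size g <= k)%N -> L ((1 - 'X) * T * g) = 0.
    by move=> /To <-; rewrite mulr1.
  have [E1 E2 E3] := node_poly_odd Ls L1 Lp Lgt0 Tm sT Ts To' bM ME.
  by split=> //; rewrite mul1r.
Qed.

(** The nodes coming from [T]; they are the ones doubled in the Hermite interpolation. *)
Let interior : pred 'I_(k.+1 + e) := fun i => ~~ (e && (alpha i == -1)).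

Lemma node_factorE (T : {poly R}) : Z = b1X * T ->
  T = \prod_(i | interior i) ('X - (alpha i)%:P).
Proof.
move=> ZE; have b0 := monic_neq0 b1X_monic; apply: (mulfI b0); rewrite -ZE.
have [e0|e1] : e = false \/ e = true by case: (e); [right|left].
  rewrite b1X_odd// mul1r; apply: eq_bigl => i.
  by rewrite /interior negb_and (_ : ~~ e = true)// e0.
have [i0 ai0] : exists i0, alpha i0 = -1.
  have : Z.[-1] == 0 by rewrite ZE b1X_even// hornerM hornerXsubC subrr mul0r.
  rewrite horner_prod => /prodf_eq0[i _]; rewrite hornerXsubC subr_eq0 => /eqP a1.
  by exists i.
rewrite b1X_even// (bigD1 i0)//= ai0; congr (_ * _).
apply: eq_bigl => i; rewrite /interior negb_and (_ : ~~ e = false); last by rewrite e1.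
by rewrite -ai0 (inj_eq alpha_inj).
Qed.

Lemma card_interior_node : #|interior| = k.+1.
Proof.
have [T [_ sT _ /node_factorE TE _]] := levenshtein_node_factor.
have {}TE : T = \prod_(x <- [seq alpha i | i in interior]) ('X - x%:P).
  by rewrite big_image TE.
by apply/eq_add_S; rewrite -sT TE size_prod_XsubC size_image.
Qed.

Lemma interior_node_itv i : interior i -> -1 < alpha i < 1.
Proof.
move=> di; have [T [Tm sT Ts /node_factorE TE To]] := levenshtein_node_factor.
have [_ T1 TN1 _] := levenshtein_node_signs Tm sT Ts To.
pose rs := [seq alpha i | i in interior].
have srs : size rs = k.+1 by rewrite size_image card_interior_node.
have {}TE : T = \prod_(x <- rs) ('X - x%:P) by rewrite big_image TE.
apply: (roots_in_itv Ls Lgt0 (w := (1 - 'X) * b1X) (rs := rs)).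
- rewrite mulf_neq0 ?(monic_neq0 b1X_monic)// -opprB oppr_eq0 -polyC1.
  by rewrite polyXsubC_eq0.
- move=> t /andP[t1 t2]; rewrite hornerM horner_b1X hornerD hornerN hornerX hornerC.
  by rewrite mulr_ge0 ?subr_ge0 ?exprn_ge0 ?ltW// -ltrBlDl sub0r.
- by move=> g; rewrite srs ltnS -TE; exact: To.
- by rewrite -TE.
- by rewrite -TE srs.
- by apply/mapP; exists i; rewrite ?mem_enum.
Qed.

Lemma node_itv i : -1 <= alpha i < 1.
Proof.
have [/interior_node_itv/andP[a1 ->]|] := boolP (interior i); first by rewrite ltW.
by rewrite negbK => /andP[_ /eqP ->]; rewrite lexx; lra.
Qed.

Let M_gt0 : 0 < M.
Proof. by apply: le_lt_trans delsarte_lt; rewrite ler0n. Qed.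

Lemma levenshtein_quadrature (f : {poly R}) : (size f <= 2 * k.+1 + e)%N ->
  L f = f.[1] / M + \sum_i levenshtein_weight d.+2 M alpha i * f.[alpha i].
Proof.
move=> sf; have [T [Tm sT Ts ZE To]] := levenshtein_node_factor.
have [TL T1 _ _] := levenshtein_node_signs Tm sT Ts To.
apply: (quadrature Ls alpha_inj (M := M) (m := k)).
- rewrite ZE hornerM horner_b1X mulf_neq0 ?gt_eqF// exprn_gt0//.
- by rewrite ZE TL mulrAC divff ?mul1r// gt_eqF.
- by move=> u su; rewrite ZE mulrA; exact: To.
- by rewrite (leq_trans sf)//; lia.
Qed.

(** A test polynomial within the exactness degree that vanishes at 1 and at all other nodes reduces
    the quadrature formula to [L f = rho_i f(alpha_i)]. *)
Lemma levenshtein_weight_gt0 i : 0 < levenshtein_weight d.+2 M alpha i.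
Proof.
have [T [Tm sT Ts ZE To]] := levenshtein_node_factor.
have [TL T1 TN1 LT] := levenshtein_node_signs Tm sT Ts To.
have TE := node_factorE ZE.
suff [f [sf f1 f0 fi]] : exists f : {poly R}, [/\ (size f <= 2 * k.+1 + e)%N,
    f.[1] = 0, forall j, j != i -> f.[alpha j] = 0 & 0 < L f * f.[alpha i]].
  have fa0 : f.[alpha i] != 0 by apply: contraTneq fi => ->; rewrite mulr0 ltxx.
  rewrite -(pmulr_lgt0 _ (_ : 0 < f.[alpha i] ^+ 2)); last by rewrite exprn_even_gt0.
  move: fi; rewrite levenshtein_quadrature// f1 mul0r add0r (bigD1 i)//= big1 ?addr0.
    by rewrite expr2 mulrA.
  by move=> j ji; rewrite f0// mulr0.
have [di|ndi] := boolP (interior i); last first.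
  move: (ndi); rewrite negbK => /andP[e1 /eqP ai].
  (* At the node -1 a square is not possible: [(1 - 'X) * T ^+ 2] exceeds the exactness degree by
     one. The sign of [L] is supplied by [node_poly_even] instead. *)
  exists ((1 - 'X) * T); split.
  - rewrite (leq_trans (size_polyMleq _ _))// sT -opprB size_polyN -polyC1 size_XsubC e1.
    by rewrite /=; clear; lia.
  - by rewrite hornerM hornerD hornerN hornerX hornerC subrr mul0r.
  - move=> j ji; rewrite hornerM TE.
    have dj : interior j by apply: contra ji => /andP[_]; rewrite -ai (inj_eq alpha_inj).
    by rewrite (bigD1 j)//= [(_ * \prod_(_ | _) _).[_]]hornerM hornerXsubC subrr mul0r mulr0.
  - rewrite ai hornerM hornerD hornerN hornerX hornerC.
    rewrite [X in 0 < X](_ : _ = 2 * ((-1) ^+ k.+1 * L ((1 - 'X) * T)) * ((-1) ^+ k.+1 * T.[-1])).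
      by apply: mulr_gt0 => //; apply: mulr_gt0 => //; exact: LT.
    rewrite [RHS](_ : _ = ((-1) ^+ k.+1) ^+ 2 * (2 * L ((1 - 'X) * T) * T.[-1])); last by ring.
    by rewrite sqrr_sign; ring.
pose g : {poly R} := \prod_(j | interior j && (j != i)) ('X - (alpha j)%:P).
have TgE : T = ('X - (alpha i)%:P) * g by rewrite TE (bigD1 i).
have g0 : g != 0 by apply: contra_eq_neq sT => g0; rewrite TgE g0 mulr0 size_poly0.
have sg : size g = k.+1 by move: sT; rewrite TgE size_XsubCM// => -[].
have gi : g.[alpha i] != 0.
  rewrite horner_prod; apply/prodf_neq0 => j /andP[_ ji].
  by rewrite hornerXsubC subr_eq0 (inj_eq alpha_inj) eq_sym.
have /andP[a1 a2] := interior_node_itv di.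
pose f := (1 - 'X) * b1X * g ^+ 2.
have X0 : (1 - 'X : {poly R}) != 0 by rewrite -opprB oppr_eq0 -polyC1 polyXsubC_eq0.
have ft t : f.[t] = (1 - t) * (1 + t) ^+ e * g.[t] ^+ 2.
  by rewrite /f !hornerM horner_b1X hornerD hornerN hornerX hornerC expr2.
have fpos t : -1 < t < 1 -> 0 <= f.[t].
  move=> /andP[t1 t2]; rewrite ft mulr_ge0 ?sqr_ge0// mulr_ge0 ?subr_ge0 ?exprn_ge0 ?ltW//.
  by rewrite -ltrBlDl sub0r.
exists f; split.
- rewrite /f (leq_trans (size_polyMleq _ _))// expr2.
  have s1 : (size ((1 - 'X) * b1X)%R <= 2 + e)%N.
    rewrite (leq_trans (size_polyMleq _ _))// size_b1X -opprB size_polyN -polyC1 size_XsubC.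
    by rewrite addnS.
  have s2 : (size (g * g)%R <= 2 * k + 1)%N.
    by rewrite (leq_trans (size_polyMleq _ _))// sg addnS /= addSn addn1 mul2n addnn.
  rewrite -subn1 leq_subLR (leq_trans (leq_add s1 s2))//; clear; lia.
- by rewrite ft subrr !mul0r.
- move=> j ji; rewrite ft; have [dj|] := boolP (interior j).
    rewrite /g (bigD1 j) ?dj//= hornerM hornerXsubC subrr mul0r expr0n/= mulr0//.
  by rewrite negbK => /andP[-> /eqP ->]; rewrite subrr expr1 mulr0 mul0r.
- rewrite mulr_gt0//.
    by apply: Lgt0 => //; rewrite /f mulf_neq0 ?expf_neq0// mulf_neq0// (monic_neq0 b1X_monic).
  rewrite ft mulr_gt0 ?exprn_even_gt0// mulr_gt0 ?subr_gt0 ?exprn_gt0//.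
  by rewrite -ltrBlDl sub0r.
Qed.

End levenshtein_nodes.

(** * The energy bound and its optimality among lower polynomials *)

Theorem theorem5p4 (R : realType) (n N tau k : nat) (e : bool)
    (C : 'I_N -> 'rV[R]_n) (W : 'I_N -> R) (h : R -> \bar R)
    (s : R) (alpha : 'I_(k + e) -> R) :
  (2 <= n)%N -> (1 <= k)%N -> tau = (2 * k - 1 + e)%N ->
  weighted_design tau C W ->
  (delsarte_bound n tau)%:R < NW W <= (delsarte_bound n tau.+1)%:R ->
  levenshtein_interval n k e s -> levenshtein_fun n k e s = NW W ->
  (forall i j : 'I_(k + e), (i < j)%N -> alpha i < alpha j) ->
  (forall t : R, root (levenshtein_poly n k e s) t <-> exists i, alpha i = t) ->
  potential h -> nonneg_nth_derivative tau.+1 h ->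
  let rho := levenshtein_weight n (NW W) alpha in
  (\sum_(i < k + e) (rho i)%:E * h (alpha i) <= energy h C W)%E /\
  (forall f : {poly R}, lower_polys tau h f ->
     ((gegenbauer_coefs n f 0%N - f.[1] * \sum_(i < N) W i ^+ 2)%:E
        <= \sum_(i < k + e) (rho i)%:E * h (alpha i))%E).
Proof.
case: n C => [|[|d]]// C _; case: k alpha => [|k]// alpha _ tauE WD /andP[NWgt _] _ levE.
move=> alpha_lt alpha_root [_ hfin _] [g hg g0] rho.
have ai : injective alpha.
  move=> i j aij; apply/val_inj/eqP; case: ltngtP => // /alpha_lt; rewrite aij ltxx//.
rewrite tauE in NWgt.
have node := node_itv ai alpha_root NWgt levE.
have tau1 : tau.+1 = (2 * k.+1 + e)%N by rewrite tauE; lia.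
(* The quadrature term at 1 cancels the diagonal term, so the linear programming bound of any
   admissible [f] is its sum over the nodes. Both claims become comparisons with [h] at the
   nodes. *)
have quad (f : {poly R}) : (size f <= tau.+1)%N ->
    mu_int d.+2 f - f.[1] * \sum_(i < N) W i ^+ 2 = \sum_i rho i * f.[alpha i].
  rewrite tau1 => /(levenshtein_quadrature ai alpha_root NWgt levE) ->.
  by rewrite /NW invrK addrC addKr.
have hE t : -1 <= t < 1 -> h t = (fine (h t))%:E by move=> /hfin/fineK.
have hsum : (\sum_(i < k.+1 + e) (rho i)%:E * h (alpha i) =
    (\sum_(i < k.+1 + e) rho i * fine (h (alpha i)))%:E)%E.
  by rewrite -sumEFin; apply: eq_bigr => i _; rewrite [in LHS]hE// -EFinM.
split; rewrite hsum; last first.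
  move=> f [sf fh]; rewrite gegenbauer_coefs0 quad// lee_fin.
  apply: ler_sum => i _.
  rewrite ler_wpM2l ?(ltW (levenshtein_weight_gt0 ai alpha_root NWgt levE i))//.
  by rewrite -lee_fin -hE// fh.
have [h1 hh1 h1g] := is_nth_derivativeSl hg.
pose dbl i := ~~ (e && (alpha i == -1)).
have cd : #|dbl| = k.+1 := card_interior_node ai alpha_root.
have [p [sp pa p'a]] := hermite_interpolation dbl ai (fine \o h \o alpha) (h1 \o alpha).
(* The number of Hermite conditions is exactly the dimension of the polynomials of degree at most
   [tau]. *)
have Nc : (k.+1 + e + #|dbl| = tau.+1)%N by rewrite cd tau1; lia.
rewrite Nc in sp.
have ph t : -1 <= t < 1 -> p.[t] <= fine (h t).
  move=> t1; apply: (hermite_le (f := fine \o h) ai Nc _ _ hh1 h1g _ sp pa p'a).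
  - by move=> i; rewrite /= in_itv/=; exact: node.
  - by move=> i; rewrite negbK => /andP[_ /eqP ->] y; rewrite /= in_itv/= => /andP[].
  - by move=> y; rewrite /= in_itv/=; exact: g0.
  - by rewrite /= in_itv.
have /(_ h)E := energy_lower_bound WD sp.
apply: le_trans (E _); last by move=> t t1; rewrite hE// lee_fin ph.
by rewrite quad// lee_fin; apply: ler_sum => j _; rewrite pa.
Qed.
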